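(* Let $F$ be an order continuous Banach lattice. Then every dispersed closed subspace of $F$ is reflexive, and every DNS operator from $F$ into a Banach space is tauberian.
   Context: A sequence $(e_n)$ in the unit sphere of a closed subspace $E\subset F$ is almost disjoint if there is a disjoint sequence $(f_n)\subset F$ (i.e. $|f_n|\wedge|f_m|=0$ for $n\ne m$) with $\|e_n-f_n\|\to0$; $E$ is dispersed if it contains no almost disjoint sequence. A bounded operator $T:F\to H$ is DNS if for every disjoint sequence of nonzero vectors $(f_n)$ in $F$, the restriction of $T$ to $\overline{\mathrm{span}}\{f_n\}$ is not strictly singular (not bounded below on any infinite-dimensional subspace); equivalently no disjoint normalized sequence $(f_n)$ satisfies $\|Tf_n\|\to0$. $T:F\to H$ between Banach spaces is tauberian if $(T^{**})^{-1}(H)\subset F$ (viewing $F\subset F^{**}$, $H\subset H^{**}$). *)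

(* Defs.v *)
From HB Require Import structures.
From mathcomp Require Import all_boot all_order all_algebra.
From mathcomp Require Import all_classical all_reals all_analysis.
Set Implicit Arguments. Unset Strict Implicit. Unset Printing Implicit Defensive.
Import Order.TTheory GRing.Theory Num.Theory.
Import numFieldNormedType.Exports.
Local Open Scope classical_set_scope.
Local Open Scope ring_scope.

Section BanachLattice.
Variables (R : realType) (V : completeNormedModType R).
Variables (le : V -> V -> Prop) (join : V -> V -> V).

Definition lmeet (x y : V) : V := - join (- x) (- y).
Definition labs (x : V) : V := join x (- x).

Record is_banach_lattice : Prop := {
  bl_refl : forall x, le x x;
  bl_antisym : forall x y, le x y -> le y x -> x = y;
  bl_trans : forall x y z, le x y -> le y z -> le x z;
  bl_add : forall x y z, le x y -> le (x + z) (y + z);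
  bl_scale : forall (a : R) x y, 0 <= a -> le x y -> le (a *: x) (a *: y);
  bl_join_ub_l : forall x y, le x (join x y);
  bl_join_ub_r : forall x y, le y (join x y);
  bl_join_lub : forall x y z, le x z -> le y z -> le (join x y) z;
  bl_norm : forall x y, le (labs x) (labs y) -> `|x| <= `|y|
}.

Definition order_continuous : Prop :=
  forall (I : Type) (leI : I -> I -> Prop) (x : I -> V),
    (forall i, leI i i) ->
    (forall i j k, leI i j -> leI j k -> leI i k) ->
    (forall i j, exists k, leI i k /\ leI j k) ->
    (forall i j, leI i j -> le (x j) (x i)) ->
    (forall i, le 0 (x i)) ->
    (forall y, (forall i, le y (x i)) -> le y 0) ->
    forall e : R, 0 < e -> exists i0, forall i, leI i0 i -> `|x i| < e.

Definition disjoint_seq (f : nat -> V) : Prop :=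
  forall n m, n <> m -> lmeet (labs (f n)) (labs (f m)) = 0.

Definition closed_subspace (E : set V) : Prop :=
  closed E /\ E 0 /\ (forall (a : R) x y, E x -> E y -> E (a *: x + y)).

Definition almost_disjoint (E : set V) (e : nat -> V) : Prop :=
  (forall n, E (e n) /\ `|e n| = 1) /\
  exists f : nat -> V, disjoint_seq f /\
    forall eps : R, 0 < eps -> exists N, forall n, (N <= n)%N -> `|e n - f n| < eps.

Definition dispersed (E : set V) : Prop :=
  ~ exists e : nat -> V, almost_disjoint E e.

End BanachLattice.

Section Duality.
Variables (R : realType) (W : normedModType R).

(* phi (a function W -> R) represents an element of the dual E^* of the
   subspace E : bounded linear on E (values off E are irrelevant) *)
Definition is_dual (E : set W) (phi : W -> R) : Prop :=
  (forall (a : R) x y, E x -> E y -> phi (a *: x + y) = a * phi x + phi y) /\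
  exists C : R, forall x, E x -> `|phi x| <= C * `|x|.

(* Phi represents an element of the bidual E^** : a well-defined (depending only
   on the restriction to E), linear functional on E^*, bounded w.r.t. the dual norm
   (||phi|| = least M with |phi x| <= M ||x|| on E). *)
Definition is_bidual (E : set W) (Phi : (W -> R) -> R) : Prop :=
  (forall phi psi, is_dual E phi -> is_dual E psi ->
     (forall x, E x -> phi x = psi x) -> Phi phi = Phi psi) /\
  (forall (a : R) phi psi, is_dual E phi -> is_dual E psi ->
     Phi (fun x => a * phi x + psi x) = a * Phi phi + Phi psi) /\
  exists C : R, forall phi (M : R), is_dual E phi -> 0 <= M ->
     (forall x, E x -> `|phi x| <= M * `|x|) -> `|Phi phi| <= C * M.

Definition reflexive_subspace (E : set W) : Prop :=
  forall Phi, is_bidual E Phi ->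
    exists x, E x /\ forall phi, is_dual E phi -> Phi phi = phi x.

End Duality.

Definition bounded_linear (R : realType) (V W : normedModType R) (T : V -> W) : Prop :=
  (forall (a : R) x y, T (a *: x + y) = a *: T x + T y) /\
  exists C : R, forall x, `|T x| <= C * `|x|.

(* T : F -> H tauberian: (T^** )^{-1}(H) is contained in F, where
   T^** Phi = fun psi => Phi (psi \o T) *)
Definition tauberian (R : realType) (V W : normedModType R) (T : V -> W) : Prop :=
  forall Phi : (V -> R) -> R, is_bidual setT Phi ->
    (exists h : W, forall psi, is_dual setT psi -> Phi (psi \o T) = psi h) ->
    exists x : V, forall phi, is_dual setT phi -> Phi phi = phi x.

Definition span_closure (R : realType) (V : normedModType R) (f : nat -> V) : set V :=
  closure [set x | exists (n : nat) (a : nat -> R), x = \sum_(i < n) a i *: f i].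

Definition inf_dim_subspace (R : realType) (V : normedModType R) (M : set V) : Prop :=
  M 0 /\ (forall (a : R) x y, M x -> M y -> M (a *: x + y)) /\
  forall n : nat, exists v : nat -> V, (forall i, M (v i)) /\
    forall a : nat -> R, \sum_(i < n) a i *: v i = 0 -> forall i, (i < n)%N -> a i = 0.

Definition strictly_singular_on (R : realType) (V W : normedModType R) (T : V -> W)
  (S : set V) : Prop :=
  forall M : set V, M `<=` S -> inf_dim_subspace M ->
    ~ exists c : R, 0 < c /\ forall x, M x -> c * `|x| <= `|T x|.

Definition DNS (R : realType) (V : completeNormedModType R)
  (le : V -> V -> Prop) (join : V -> V -> V) (W : normedModType R) (T : V -> W) : Prop :=
  forall f : nat -> V, (forall n, f n <> 0) -> disjoint_seq join f ->
    ~ strictly_singular_on T (span_closure f).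

(* Main.v *)
Require Import Defs.
From HB Require Import structures.
From mathcomp Require Import all_boot all_order all_algebra.
From mathcomp Require Import all_classical all_reals all_analysis.
From mathcomp Require Import ring lra.
Import Order.TTheory GRing.Theory Num.Theory.
Import numFieldNormedType.Exports.
Local Open Scope classical_set_scope.
Local Open Scope ring_scope.

Set Implicit Arguments.
Unset Strict Implicit.
Unset Printing Implicit Defensive.

(** For Phi in the bidual of a closed subspace E (with T^** Phi = h in H) that is
    not given by a point of E, Goldstine's theorem provides bounded convex sets A
    of points x of E on which finitely many functionals are close to their values
    under Phi and T x is close to h.  Two points x, y of A can be kept at distance
    at least theta by prescribing one more functional.  Minimizing along shrinking
    A a functional G(x) = sum_j phi |x - c_j u|, where phi is positive and strictly
    positive on [0, u], makes x and y close "in measure": |x - y| /\ u is small in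
    norm.  Iterating against the previous differences gives w_n = x_n - y_n in E
    which are bounded below, satisfy T w_n -> 0 and are close to a disjoint
    sequence f_n.  With T = 0 this contradicts dispersedness of E.  With E = V it
    contradicts DNS: coordinates along disjoint vectors are contractive up to
    scaling, so T is a norm limit of finite rank operators on the closed span of
    a tail of (f_n). *)

(** * The Hahn-Banach theorem *)

(** The obstacle is that x and y being weakly close says nothing about |x - y| /\ u, and the usual
    remedy, representing V inside some L^1(mu), asks for a weak unit. Here one interval [0, u]
    matters at a time: u is a multiple of the sum of the earlier |w_i|, and order continuity yields
    a positive phi such that phi-small elements of [0, u] are norm-small. The L^1-type seminorm phi
    |x| is not strictly convex, but for reals |x - c| + |y - c| exceeds |x + y - 2c| exactly when c
    lies strictly between x and y. Summing over a fine grid of c therefore detects that x and y are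
    apart. Exact minimizers need not exist, so near-minimizers in nested convex sets take their
    place, chosen at a stage where the infimum can hardly grow any more. *)

Section HahnBanach.
Variable R : realType.

Definition linfun_R (V : lmodType R) (phi : V -> R) :=
  forall (a : R) x y, phi (a *: x + y) = a * phi x + phi y.

Section Linfun.
Variables (V : lmodType R) (phi : V -> R).
Hypothesis hphi : linfun_R phi.

Lemma linR0 : phi 0 = 0.
Proof. by have := hphi (-1) 0 0; rewrite scaler0 addr0; lra. Qed.

Lemma linRZ a x : phi (a *: x) = a * phi x.
Proof. by have := hphi a x 0; rewrite linR0 !addr0. Qed.

Lemma linRD x y : phi (x + y) = phi x + phi y.
Proof. by have := hphi 1 x y; rewrite scale1r mul1r. Qed.

Lemma linRN x : phi (- x) = - phi x.
Proof. by rewrite -scaleN1r linRZ mulN1r. Qed.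

Lemma linRB x y : phi (x - y) = phi x - phi y.
Proof. by rewrite linRD linRN. Qed.

Lemma linR_sum n (f : 'I_n -> V) : phi (\sum_i f i) = \sum_i phi (f i).
Proof.
elim/big_ind2 : _ => [||//]; first exact: linR0.
by move=> x1 x2 y1 y2 <- <-; rewrite linRD.
Qed.

End Linfun.

Definition sublinear (V : lmodType R) (q : V -> R) :=
  (forall x y, q (x + y) <= q x + q y) /\
  (forall (t : R) x, 0 <= t -> q (t *: x) = t * q x).

Lemma sublinear0 (V : lmodType R) (q : V -> R) : sublinear q -> q 0 = 0.
Proof. by case=> _ h; rewrite -(scale0r (0 : V)) h ?mul0r. Qed.

Section InfSublinear.
Variables (V U : lmodType R) (C : set U) (F : V -> U -> R).
Hypotheses (C0 : C 0) (CD : forall i j, C i -> C j -> C (i + j))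
  (CZ : forall (t : R) i, 0 < t -> C i -> C (t *: i)).
Hypotheses (F00 : F 0 0 <= 0) (F0 : forall i, C i -> 0 <= F 0 i)
  (FD : forall x y i j, C i -> C j -> F (x + y) (i + j) <= F x i + F y j)
  (FZ : forall (t : R) x i, 0 < t -> C i -> F (t *: x) (t *: i) <= t * F x i).

Let p x := inf [set F x i | i in C].

Let has_lb x : has_lbound [set F x i | i in C].
Proof.
exists (- F (- x) 0) => _ [i Ci <-].
have := FD x (- x) Ci C0; rewrite subrr addr0; have := F0 Ci; lra.
Qed.

Let nonempty x : [set F x i | i in C] !=set0.
Proof. by exists (F x 0); exists 0. Qed.

Lemma inf_sublinear_le x i : C i -> p x <= F x i.
Proof. by move=> Ci; apply: ge_inf; [exact: has_lb|exists i]. Qed.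

Lemma inf_sublinear_lt x (a : R) : p x < a -> exists2 i, C i & F x i < a.
Proof.
move=> /(inf_lt (nonempty x))[_ [i Ci <-] h]; by exists i.
Qed.

Let pD x y : p (x + y) <= p x + p y.
Proof.
suff h i : C i -> p (x + y) - p y <= F x i.
  by rewrite -lerBlDr; apply: lb_le_inf => // _ [i Ci <-]; exact: h.
move=> Ci; rewrite lerBlDr -lerBlDl.
apply: lb_le_inf => // _ [j Cj <-]; rewrite lerBlDl.
by apply: le_trans (FD _ _ Ci Cj); apply: inf_sublinear_le; exact: CD.
Qed.

Let pZ (t : R) x : 0 < t -> p (t *: x) <= t * p x.
Proof.
move=> t0; rewrite mulrC -ler_pdivrMr//.
apply: lb_le_inf => // _ [i Ci <-]; rewrite ler_pdivrMr// mulrC.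
by apply: le_trans (FZ _ t0 Ci); apply: inf_sublinear_le; exact: CZ.
Qed.

(** [F0] keeps the infimum finite, since 0 <= F 0 i <= F x i + F (-x) 0, and [FZ] is applied both to
    t and to t^-1. The construction serves three times: for slopes, for the seminorm in Goldstine's
    theorem and for the distance to a disjoint complement. *)
Lemma inf_sublinear : sublinear p.
Proof.
split=> // t x; rewrite le_eqVlt => /predU1P[<-|t0].
  rewrite scale0r mul0r; apply/eqP; rewrite eq_le.
  rewrite (le_trans (inf_sublinear_le _ C0) F00)/=.
  by apply: lb_le_inf => // _ [i Ci <-]; exact: F0.
apply/eqP; rewrite eq_le pZ//=.
have := pZ (t *: x) (_ : 0 < t^-1); rewrite invr_gt0 => /(_ t0).
by rewrite scalerA mulVf ?gt_eqF// scale1r ler_pdivlMl.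
Qed.

End InfSublinear.

(* Slope of q along y: it lies below q, is still sublinear, and a minimal
   sublinear functional coincides with all of its slopes, hence is additive. *)
Definition slope (V : lmodType R) (q : V -> R) (y x : V) : R :=
  inf [set q (x + (t : R) *: y) - t * q y | t in [set t : R^o | 0 <= t]].

Section Slope.
Variables (V : lmodType R) (q : V -> R) (y : V).
Hypothesis hq : sublinear q.
(** The half-line is taken in [R^o] because the cone of the previous section sits in an
    [lmodType]. *)
Let C := [set t : R^o | 0 <= t].
Let F (x : V) (t : R^o) : R := q (x + (t : R) *: y) - t * q y.

Let sl : sublinear (slope q y) /\
  forall x (t : R), 0 <= t -> slope q y x <= q (x + t *: y) - t * q y.
Proof.
have [qD qZ] := hq.
have C0 : C 0 by rewrite /C/=.
have CD : forall i j, C i -> C j -> C (i + j) by move=> i j Ci Cj; apply: (@addr_ge0 R).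
have CZ : forall (t : R) i, 0 < t -> C i -> C (t *: i).
  by move=> t i t0 Ci; apply: (@mulr_ge0 R) => //; exact: ltW.
have F00 : F 0 0 <= 0 by rewrite /F scale0r addr0 mul0r subr0 sublinear0.
have F0 : forall i, C i -> 0 <= F 0 i.
  by move=> i Ci; rewrite /F add0r qZ// subrr.
have FD : forall x x' i j, C i -> C j -> F (x + x') (i + j) <= F x i + F x' j.
  move=> x x' i j Ci Cj; rewrite /F mulrDl scalerDl addrACA.
  by have := qD (x + i *: y) (x' + j *: y); lra.
have FZ : forall (t : R) x i, 0 < t -> C i -> F (t *: x) (t *: i) <= t * F x i.
  move=> t x i t0 Ci; rewrite /F -scalerA -scalerDr (qZ _ _ (ltW t0)) mulrBr.
  by rewrite mulrA; exact: lexx.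
split; first exact: inf_sublinear.
by move=> x t t0; exact: (@inf_sublinear_le _ _ C F).
Qed.

Lemma slope_sublinear : sublinear (slope q y).
Proof. exact: sl.1. Qed.

Lemma slope_le x (t : R) : 0 <= t -> slope q y x <= q (x + t *: y) - t * q y.
Proof. exact: sl.2. Qed.

Lemma slope_le_self x : slope q y x <= q x.
Proof. by have := slope_le x (lexx 0); rewrite scale0r addr0 mul0r subr0. Qed.

End Slope.

Lemma minimal_sublinear (V : lmodType R) (q : V -> R) : sublinear q ->
  exists p, [/\ sublinear p, forall x, p x <= q x &
    forall p', sublinear p' -> (forall x, p' x <= p x) -> p' = p].
Proof.
move=> hq.
pose T := {p : V -> R | sublinear p /\ forall x, p x <= q x}.
(* The order is reversed, so that the maximal element given by [Zorn] is a minimal functional. *)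
pose le (p p' : T) := `[< forall x, sval p' x <= sval p x >].
have := @Zorn T le; case.
- by move=> p; apply/asboolP.
- move=> p p' p'' /asboolP h /asboolP h'; apply/asboolP => x.
  exact: le_trans (h' x) (h x).
- move=> [p hp] [p' hp'] /asboolP/= h /asboolP/= h'; apply: eq_exist => /=.
  by apply/funext => x; apply/eqP; rewrite eq_le h h'.
- move=> A Atot; have [[a0 Aa0]|A0] := pselect (A !=set0); last first.
    by exists (exist _ q (conj hq (fun x => lexx _))) => s As; case: A0; exists s.
  pose S x := [set sval a x | a in A].
  have S0 x : S x !=set0 by exists (sval a0 x); exists a0.
  have Slb x : has_lbound (S x).
    exists (- q (- x)) => _ [[a [[aD aZ] aq]] Aa <-]/=.
    have := aD x (- x); rewrite subrr sublinear0//; have := aq (- x); lra.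
  pose p x := inf (S x).
  have ple x a : A a -> p x <= sval a x by move=> Aa; apply: ge_inf => //; exists a.
  have hp : sublinear p /\ forall x, p x <= q x.
    split; last first.
      by move=> x; apply: le_trans (ple x _ Aa0) _; case: a0 {Aa0} => a [].
    split=> [x y|t x t0].
    + rewrite -lerBlDr; apply: lb_le_inf => // _ [a Aa <-].
      rewrite lerBlDr -lerBlDl; apply: lb_le_inf => // _ [b Ab <-].
      (* By totality of the chain, the smaller of [a] and [b] is subadditive and lies below both. *)
      rewrite lerBlDl; have [/asboolP h|/asboolP h] := Atot a b Aa Ab.
        apply: le_trans (ple _ _ Ab) _; case: (svalP b) => -[bD _] _.
        by apply: le_trans (bD _ _) _; rewrite lerD2r.
      apply: le_trans (ple _ _ Aa) _; case: (svalP a) => -[bD _] _.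
      by apply: le_trans (bD _ _) _; rewrite lerD2l.
    + have aZ (a : T) : sval a (t *: x) = t * sval a x.
        by case: (svalP a) => -[_ ->].
      move: t0; rewrite le_eqVlt => /predU1P[t0|t0].
        rewrite -t0 scale0r mul0r; apply/eqP; rewrite eq_le; apply/andP; split.
          by apply: le_trans (ple _ _ Aa0) _; case: (svalP a0) => h _; rewrite sublinear0.
        by apply: lb_le_inf => // _ [b Ab <-]; case: (svalP b) => h _; rewrite sublinear0.
      apply/eqP; rewrite eq_le; apply/andP; split.
        rewrite mulrC -ler_pdivrMr//; apply: lb_le_inf => // _ [b Ab <-].
        by rewrite ler_pdivrMr// mulrC -aZ; exact: ple.
      by apply: lb_le_inf => // _ [b Ab <-]; rewrite aZ ler_pM2l//; exact: ple.
  exists (exist _ p hp) => s As; apply/asboolP => x/=; exact: ple.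
move=> [p [hp pq]] pmin; exists p; split=> // p' hp' p'p.
have hp'q x : p' x <= q x by exact: le_trans (p'p x) (pq x).
have := pmin (exist _ p' (conj hp' hp'q)) => /(_ _)/(congr1 sval)/= -> //.
exact/asboolP.
Qed.

(** Minimizing below [slope q x0] instead of q fixes the value at x0: this slope is at most - q x0
    at - x0, so additivity of the minimal p gives p x0 >= q x0. *)
Theorem hahn_banach (V : lmodType R) (q : V -> R) (x0 : V) : sublinear q ->
  exists phi, [/\ linfun_R phi, forall x, phi x <= q x & phi x0 = q x0].
Proof.
move=> hq; have [p [hp pq pmin]] := minimal_sublinear (slope_sublinear x0 hq).
have pD x y : p (x + y) = p x + p y.
  apply/eqP; rewrite eq_le; case: (hp) => -> _ /=.
  have <- : slope p y = p.
    by apply: pmin; [exact: slope_sublinear|move=> z; exact: slope_le_self].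
  have := slope_le y hp x ler01; rewrite scale1r mul1r.
  have := slope_le_self y hp (x + y).
  rewrite (_ : slope p y = p); first lra.
  by apply: pmin; [exact: slope_sublinear|move=> z; exact: slope_le_self].
have pN x : p (- x) = - p x.
  by have := pD x (- x); rewrite subrr sublinear0//; lra.
have pZ a x : p (a *: x) = a * p x.
  case: hp => _ hZ; have [a0|a0] := leP 0 a; first exact: hZ.
  by rewrite -[a]opprK scaleNr pN hZ ?mulNr// oppr_ge0 ltW.
exists p; split.
- by move=> a x y; rewrite pD pZ.
- by move=> x; apply: le_trans (pq x) _; exact: slope_le_self.
apply/eqP; rewrite eq_le (le_trans (pq x0) (slope_le_self _ hq _))/=.
have := pq (- x0); rewrite pN => h; have := slope_le x0 hq (- x0) ler01.
by rewrite scale1r addNr mul1r sublinear0//; lra.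
Qed.

End HahnBanach.

(** * Banach lattices *)

Section Lattice.
Variables (R : realType) (V : completeNormedModType R).
Variables (le : V -> V -> Prop) (join : V -> V -> V).
Hypothesis BL : is_banach_lattice le join.

Local Notation "x '<=v' y" := (le x y) (at level 70).
Local Notation abs := (labs join).

Definition posp (x : V) := join x 0.

Let lexx := bl_refl BL.
Let letr := bl_trans BL.
Let joinl := bl_join_ub_l BL.
Let joinr := bl_join_ub_r BL.
Let joinP := bl_join_lub BL.

Lemma lev_sub x y : x <=v y <-> 0 <=v y - x.
Proof.
split=> h; first by rewrite -(subrr x); exact: (bl_add BL).
by have := bl_add BL x h; rewrite add0r subrK.
Qed.

Lemma lev_addv x y z t : x <=v y -> z <=v t -> x + z <=v y + t.
Proof.
move=> xy zt; apply: letr (bl_add BL z xy) _.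
by rewrite ![y + _]addrC; exact: (bl_add BL).
Qed.

Lemma posp_ge0 x : 0 <=v posp x. Proof. exact: joinr. Qed.

Lemma le_posp x : x <=v posp x. Proof. exact: joinl. Qed.

Lemma posp_le x y : x <=v y -> 0 <=v y -> posp x <=v y.
Proof. exact: joinP. Qed.

Lemma labs_ge0 x : 0 <=v abs x.
Proof.
have := lev_addv (joinl x (- x)) (joinr x (- x)); rewrite subrr => h.
have h2 : (0 : R) <= 2^-1 by rewrite invr_ge0.
have := bl_scale BL h2 h; rewrite scaler0 /labs -[X in X + X]scale1r -scalerDl.
by rewrite scalerA mulVf ?scale1r// pnatr_eq0.
Qed.

Lemma labs_pos x : 0 <=v x -> abs x = x.
Proof.
move=> x0; apply: (bl_antisym BL); last exact: joinl.
apply: joinP => //; apply: (letr _ x0).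
by have := bl_add BL (- x) x0; rewrite add0r subrr.
Qed.

Lemma norm_labs x : `|abs x| = `|x|.
Proof.
apply/eqP; rewrite eq_le; have h := labs_pos (labs_ge0 x).
by apply/andP; split; apply: (bl_norm BL); rewrite h; exact: lexx.
Qed.

Lemma norm_mono x y : 0 <=v x -> x <=v y -> `|x| <= `|y|.
Proof.
move=> x0 xy; apply: (bl_norm BL); rewrite !labs_pos//; exact: letr xy.
Qed.

Lemma norm_posp_le x : `|posp x| <= `|x|.
Proof.
rewrite -(norm_labs x); apply: norm_mono; first exact: posp_ge0.
by apply: posp_le; [exact: joinl|exact: labs_ge0].
Qed.

Lemma norm_posp_sublinear : sublinear (fun x => `|posp x|).
Proof.
split=> [x y|t x].
  apply: le_trans (ler_normD _ _); apply: norm_mono; first exact: posp_ge0.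
  apply: posp_le; first by apply: lev_addv; exact: le_posp.
  by rewrite -(addr0 0); apply: lev_addv; exact: posp_ge0.
have h (s : R) z : 0 <= s -> `|posp (s *: z)| <= s * `|posp z|.
  move=> s0; rewrite -[s in leRHS]ger0_norm// -normrZ.
  apply: norm_mono; first exact: posp_ge0.
  have hs := bl_scale BL s0 (posp_ge0 z); rewrite scaler0 in hs.
  by apply: posp_le => //; apply: (bl_scale BL) => //; exact: le_posp.
move=> t0; apply/eqP; rewrite eq_le h//=.
have [->|tn0] := eqVneq t 0; first by rewrite mul0r.
have {}t0 : 0 < t by rewrite lt_def tn0.
have := h t^-1 (t *: x); rewrite invr_ge0 => /(_ (ltW t0)).
by rewrite scalerA mulVf ?gt_eqF// scale1r ler_pdivlMl.
Qed.

Definition posfun (phi : V -> R) :=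
  [/\ linfun_R phi, forall x, 0 <=v x -> 0 <= phi x & forall x, phi x <= `|x|].

(** Domination by the norm of the positive part makes phi positive: if z >= 0 then - z has positive
    part 0, so phi (- z) <= 0. *)
Lemma posfun_norming x : exists2 phi, posfun phi & phi x = `|posp x|.
Proof.
have [phi [hl hq hx]] := hahn_banach x norm_posp_sublinear.
exists phi => //; split=> // z; last by apply: le_trans (hq z) (norm_posp_le z).
move=> z0; have := hq (- z); rewrite linRN//.
have -> : posp (- z) = 0; last by rewrite normr0; lra.
apply: (bl_antisym BL); last exact: posp_ge0.
by apply: posp_le; [apply/lev_sub; rewrite opprK add0r|exact: lexx].
Qed.

Lemma posfun_le phi x y : posfun phi -> x <=v y -> phi x <= phi y.
Proof. by case=> hl hp _ /lev_sub/hp; rewrite linRB// subr_ge0. Qed.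

(* Since positive functionals determine the order, linear consequences of
   inequalities in V can be decided by real linear arithmetic. *)
Lemma lev_test x y : (forall phi, posfun phi -> phi x <= phi y) -> x <=v y.
Proof.
move=> h; apply/lev_sub; have [phi hphi] := posfun_norming (x - y).
have [hl _ _] := hphi; have := h _ hphi; rewrite linRB// => h1 h2.
have /eqP : `|posp (x - y)| = 0.
  by apply/eqP; rewrite eq_le normr_ge0 andbT; lra.
rewrite normr_eq0 => /eqP h3; have := le_posp (x - y); rewrite h3.
by move=> /lev_sub; rewrite add0r opprB.
Qed.

(** A tuple of rewriting rules: one [rewrite] pushes phi through all module operations. *)
Lemma posfunE phi : posfun phi ->
  (((forall x y : V, (phi (x - y) = phi x - phi y)%R) *
  (forall x y : V, (phi (x + y) = phi x + phi y)%R)) *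
  ((forall x : V, (phi (- x) = - phi x)%R) *
  (forall (a : R) (x : V), (phi (a *: x) = a * phi x)%R)) * (phi 0%R = 0%R))%type.
Proof.
case=> hl _ _; split; last exact: linR0.
split; split=> *; [exact: linRB|exact: linRD|exact: linRN|exact: linRZ].
Qed.
End Lattice.

(** Each order hypothesis is replaced by its image under an arbitrary positive functional; [lra]
    then treats the values at joins and meets as atoms, so the needed lattice facts must already be
    in the context. *)
Ltac vlra_hyps BL hphi :=
  repeat match goal with
  | H : ?l ?x ?y |- _ =>
    move: (posfun_le BL hphi H); rewrite ?(posfunE hphi); clear H => H
  end.
Ltac vlra BL :=
  apply: (lev_test BL); let phi := fresh "phi" in let hphi := fresh "hphi" in
  move=> phi hphi; vlra_hyps BL hphi; rewrite ?(posfunE hphi); lra.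

(** * Identities and inequalities of vector lattices *)

Section LatticeIneq.
Variables (R : realType) (V : completeNormedModType R).
Variables (le : V -> V -> Prop) (join : V -> V -> V).
Hypothesis BL : is_banach_lattice le join.

Local Notation "x '<=v' y" := (le x y) (at level 70).
Local Notation meet := (lmeet join).
Local Notation abs := (labs join).
Local Notation posp := (posp join).

Let lexx := bl_refl BL.
Let letr := bl_trans BL.
Let joinl := bl_join_ub_l BL.
Let joinr := bl_join_ub_r BL.
Let joinP := bl_join_lub BL.
Let asym := bl_antisym BL.
Let posp0 := posp_ge0 BL.
Let lepos := le_posp BL.

Lemma meetl x y : meet x y <=v x.
Proof. have h := joinl (- x) (- y); rewrite /lmeet; vlra BL. Qed.

Lemma meetr x y : meet x y <=v y.
Proof. have h := joinr (- x) (- y); rewrite /lmeet; vlra BL. Qed.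

Lemma meetP x y z : z <=v x -> z <=v y -> z <=v meet x y.
Proof.
move=> h1 h2; have h : join (- x) (- y) <=v - z by apply: joinP; vlra BL.
rewrite /lmeet; vlra BL.
Qed.

Lemma meet_ge0 x y : 0 <=v x -> 0 <=v y -> 0 <=v meet x y.
Proof. exact: meetP. Qed.

Lemma meetS x y x' y' : x <=v x' -> y <=v y' -> meet x y <=v meet x' y'.
Proof.
by move=> hx hy; apply: meetP; [apply: letr hx; exact: meetl|apply: letr hy; exact: meetr].
Qed.

Lemma meetC x y : meet x y = meet y x.
Proof. by apply: asym; apply: meetP; (exact: meetl || exact: meetr). Qed.

Lemma joinDmeet x y : join x y + meet x y = x + y.
Proof.
apply: asym.
  have h : join x y <=v x + y - meet x y.
    by apply: joinP; [have h := meetr x y|have h := meetl x y]; vlra BL.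
  vlra BL.
have h : x + y - join x y <=v meet x y.
  by apply: meetP; [have h := joinr x y|have h := joinl x y]; vlra BL.
vlra BL.
Qed.

Lemma pospN x : posp x = x + posp (- x).
Proof.
apply: asym.
  have h1 := posp0 (- x); have h2 := lepos (- x).
  by apply: (posp_le BL); vlra BL.
have h1 := posp0 x; have h2 := lepos x.
have h : posp (- x) <=v posp x - x by apply: (posp_le BL); vlra BL.
vlra BL.
Qed.

Lemma labsE x : abs x = posp x + posp (- x).
Proof.
have e := pospN x; apply: asym.
  have h1 := posp0 (- x); have h2 := lepos (- x).
  by rewrite e; apply: joinP; vlra BL.
have h1 := joinl x (- x); have h2 := joinr x (- x); have h0 := labs_ge0 BL x.
rewrite /labs in h0 *.
have h3 : posp x <=v (1 / 2) *: (join x (- x) + x) by apply: (posp_le BL); vlra BL.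
have h4 : posp (- x) <=v (1 / 2) *: (join x (- x) - x) by apply: (posp_le BL); vlra BL.
vlra BL.
Qed.

Lemma le_labs x : x <=v abs x. Proof. exact: joinl. Qed.

Lemma leN_labs x : - x <=v abs x. Proof. exact: joinr. Qed.

Lemma labs_le x y : x <=v y -> - x <=v y -> abs x <=v y.
Proof. exact: joinP. Qed.

Lemma labsN x : abs (- x) = abs x.
Proof. by rewrite !labsE opprK addrC. Qed.

Lemma posp_le_labs x : posp x <=v abs x.
Proof. by apply: (posp_le BL); [exact: le_labs|exact: labs_ge0]. Qed.

Lemma labs_triangle x y : abs (x + y) <=v abs x + abs y.
Proof.
have h1 := le_labs x; have h2 := le_labs y.
by have h3 := leN_labs x; have h4 := leN_labs y; apply: labs_le; vlra BL.
Qed.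

Lemma labsZ (a : R) x : 0 <= a -> abs (a *: x) = a *: abs x.
Proof.
have h (b : R) z : 0 <= b -> abs (b *: z) <=v b *: abs z.
  move=> b0; apply: labs_le; last rewrite -scalerN.
    by apply: (bl_scale BL) => //; exact: le_labs.
  by apply: (bl_scale BL) => //; exact: leN_labs.
rewrite le_eqVlt => /predU1P[<-|a0]; first by rewrite !scale0r (labs_pos BL)//; exact: lexx.
apply: asym; first by apply: h; exact: ltW.
have := h a^-1 (a *: x); rewrite invr_ge0 => /(_ (ltW a0)).
move=> /(bl_scale BL (ltW a0)).
by rewrite !scalerA mulVf ?gt_eqF// mulfV ?gt_eqF// !scale1r.
Qed.

Lemma meet_posp_posn x : meet (posp x) (posp (- x)) = 0.
Proof.
apply: asym; last by apply: meet_ge0; exact: posp0.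
have e := joinDmeet (posp x) (posp (- x)).
have h : abs x <=v join (posp x) (posp (- x)).
  by apply: labs_le; [apply: letr (joinl _ _)|apply: letr (joinr _ _)]; exact: lepos.
rewrite labsE -e in h; vlra BL.
Qed.

Lemma meetD_le x y z : 0 <=v x -> 0 <=v y -> 0 <=v z ->
  meet z (x + y) <=v meet z x + meet z y.
Proof.
move=> x0 y0 z0.
have l := meetl z (x + y); have r := meetr z (x + y).
have h : meet z (x + y) - y <=v meet z x by apply: meetP; vlra BL.
have h1 := meet_ge0 z0 x0.
have h2 : meet z (x + y) - meet z x <=v meet z y by apply: meetP; vlra BL.
vlra BL.
Qed.

(* Distributivity of the lattice, in the form of a proof by cases. *)
Lemma meet_cases w a b z : w <=v join a b -> meet w a <=v z -> meet w b <=v z ->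
  w <=v z.
Proof.
move=> wab wa wb; set c := join a b in wab.
have ha : a <=v z - w + c.
  have e := joinDmeet w a.
  have h : join w a <=v c by apply: joinP => //; exact: joinl.
  apply: (lev_test BL) => phi hphi; move: (congr1 phi e).
  by vlra_hyps BL hphi; rewrite ?(posfunE hphi); lra.
have hb : b <=v z - w + c.
  have e := joinDmeet w b.
  have h : join w b <=v c by apply: joinP => //; exact: joinr.
  apply: (lev_test BL) => phi hphi; move: (congr1 phi e).
  by vlra_hyps BL hphi; rewrite ?(posfunE hphi); lra.
have h : c <=v z - w + c by apply: joinP.
vlra BL.
Qed.

(** A discrete intermediate value argument: read as conditions, a_0 and b_n hold and each j has b_j
    or a_(j+1), so at the first j with b_j both a_j and b_j hold. In the absence of points, the
    induction descends from n with [meet_cases]. *)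
Lemma meet_chain (a b : nat -> V) n g z :
  (forall j, (j <= n)%N -> meet (a j) (b j) <=v z) ->
  (forall j, (j < n)%N -> g <=v join (b j) (a j.+1)) ->
  meet (meet (a 0%N) (b n)) g <=v z.
Proof.
move=> hz hg; set w := meet _ _.
have wg : w <=v g by exact: meetr.
have wb : w <=v b n by apply: letr (meetl _ _) (meetr _ _).
suff h k : (k <= n)%N -> meet w (a (n - k)%N) <=v z.
  have := h n (leqnn n); rewrite subnn; apply: letr; apply: meetP; first exact: lexx.
  exact: letr (meetl _ _) (meetl _ _).
elim: k => [_|k IH kn].
  by rewrite subn0; apply: letr (hz n (leqnn n)); rewrite meetC; apply: meetS => //; exact: lexx.
have e : (n - k = (n - k.+1).+1)%N by rewrite subnSK.
have jn : (n - k.+1 < n)%N by rewrite ltn_subrL/=; exact: leq_ltn_trans kn.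
set j := (n - k.+1)%N in e jn *.
apply: (@meet_cases _ (b j) (a j.+1)).
- by apply: letr (hg _ jn); apply: letr wg; exact: meetl.
- by apply: letr (hz j (ltnW jn)); apply: meetS; [exact: meetr|exact: lexx].
- rewrite -e; apply: letr (IH (ltnW kn)).
  by apply: meetS; [exact: meetl|exact: lexx].
Qed.

(** For reals a < 0 < b the right-hand side equals 2 min(b, -a): the defect in the triangle
    inequality measures how deep 0 lies between a and b. *)
Lemma labs_gap a b s : s <=v posp b -> s <=v posp (- a) ->
  2 *: s <=v abs a + abs b - abs (a + b).
Proof.
move=> sb sa; have ea := pospN a; have eb := pospN b.
have a0 := posp0 (- a); have b0 := posp0 (- b); have a1 := posp0 a; have b1 := posp0 b.
suff h : abs (a + b) <=v abs a + abs b - 2 *: s by vlra BL.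
rewrite (labsE a) (labsE b); rewrite ea in a1 *; rewrite eb in b1 sb *.
by apply: labs_le; vlra BL.
Qed.

(** A Markov-type bound: if w <= u and w <= |y| - (K - 1) u, then K w = (K - 1) w + w <= |y|. It
    disposes of the part where y leaves the range of the grid. *)
Lemma meet_tail u y (K : R) : 1 < K -> 0 <=v u ->
  meet u (posp (abs y - (K - 1) *: u)) <=v K^-1 *: abs y.
Proof.
move=> K1 u0; have K0 : 0 < K by lra.
have Ki : 0 <= K^-1 by rewrite invr_ge0 ltW.
have y0 := labs_ge0 BL y.
have z0 : 0 <=v K^-1 *: abs y by rewrite -(scaler0 _ K^-1); exact: (bl_scale BL).
apply: (@meet_cases _ (abs y - (K - 1) *: u) 0); first exact: meetr.
  set w := meet (meet _ _) _.
  have h1 : w <=v u by apply: letr (meetl _ _) (meetl _ _).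
  have h2 : w <=v abs y - (K - 1) *: u by exact: meetr.
  have -> : w = K^-1 *: (K *: w) by rewrite scalerA mulVf ?scale1r ?gt_eqF.
  apply: (bl_scale BL) => //; apply: (lev_test BL) => phi hphi.
  by vlra_hyps BL hphi; rewrite ?(posfunE hphi); nra.
by apply: letr z0; exact: meetr.
Qed.
End LatticeIneq.

(** * Monotone sequences in order continuous lattices *)

Lemma half_expr_lt (R : realType) (e : R) : 0 < e -> exists N, forall n, (N <= n)%N ->
  2^-1 ^+ n < e.
Proof.
move=> e0; exists (Num.bound e^-1) => n hn.
have h1 : e^-1 < (Num.bound e^-1)%:R by apply: le_lt_trans (archi_boundP _); rewrite ?ler_norm// invr_ge0 ltW.
have h2 : ((Num.bound e^-1)%:R : R) <= (2 ^ n)%:R.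
  by rewrite ler_nat; apply: leq_trans hn _; apply: ltnW; exact: ltn_expl.
rewrite exprVn -natrX invf_plt ?posrE ?ltr0n ?expn_gt0//.
exact: lt_le_trans h2.
Qed.

Lemma cauchy_converges (R : realType) (V : completeNormedModType R) (x : nat -> V) :
  (forall e : R, 0 < e -> exists N, forall n, (N <= n)%N -> `|x n - x N| < e) ->
  exists l, forall e : R, 0 < e -> exists N, forall n, (N <= n)%N -> `|x n - l| < e.
Proof.
move=> hx; have : cvg (x @ \oo).
  apply/cauchy_cvgP; apply: cauchy_exP => e e0; have [N hN] := hx e e0.
  exists (x N), N => // n /= Nn; rewrite -ball_normE/= distrC; exact: hN.
move=> xl; exists (lim (x @ \oo)) => e e0.
have /cvgr_distC_lt/(_ e e0)[N _ hN] := xl.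
by exists N => n Nn; exact: hN.
Qed.

Section OrderContinuous.
Variables (R : realType) (V : completeNormedModType R).
Variables (le : V -> V -> Prop) (join : V -> V -> V).
Hypothesis BL : is_banach_lattice le join.

Local Notation "x '<=v' y" := (le x y) (at level 70).
Local Notation meet := (lmeet join).
Local Notation abs := (labs join).
Local Notation posp := (posp join).

Let lexx := bl_refl BL.
Let letr := bl_trans BL.
Let joinl := bl_join_ub_l BL.
Let joinr := bl_join_ub_r BL.

Lemma lev_sum n (f g : 'I_n -> V) : (forall i, f i <=v g i) ->
  \sum_i f i <=v \sum_i g i.
Proof. by move=> h; elim/big_ind2 : _ => // *; exact: (lev_addv BL). Qed.

Lemma lev_sum1 n (f : 'I_n -> V) i : (forall i, 0 <=v f i) -> f i <=v \sum_i f i.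
Proof.
move=> h; rewrite (bigD1 i)//= -[X in X <=v _]addr0; apply: (lev_addv BL) => //.
elim/big_ind : _ => // x y x0 y0; rewrite -(addr0 0); exact: (lev_addv BL).
Qed.

(* With c_j = - K + j d, each summand vanishes wherever c_j u does not separate
   x from y. *)
Lemma gap_estimate x y u (K d : R) n : 0 <=v u -> 1 < K -> 0 < d -> n%:R * d = 2 * K ->
  exists z, [/\ 0 <=v z, z <=v u,
    2 *: z <=v \sum_(j < n.+1) (abs (x - (- K + j%:R * d) *: u)
       + abs (y - (- K + j%:R * d) *: u)
       - abs (x - (- K + j%:R * d) *: u + (y - (- K + j%:R * d) *: u))) &
    meet u (posp (y - x)) <=v 2 *: z + (2 * K^-1) *: (abs x + abs y) + d *: u].
Proof.
move=> u0 K1 d0 nd.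
pose c (j : nat) : R := - K + j%:R * d.
pose a j := posp (y - c j *: u); pose b j := posp (c j *: u - x).
have a0 j : 0 <=v a j by exact: (posp_ge0 BL).
have b0 j : 0 <=v b j by exact: (posp_ge0 BL).
pose s j := meet (a j) (b j).
have s0 j : 0 <=v s j by apply: (meet_ge0 BL).
(* Since (c_j u - x) + (y - c_(j+1) u) = y - x - d u, one of the two summands is at least half of
   the right-hand side; this is the condition linking b_j and a_(j+1). *)
pose g := posp ((1 / 2) *: (y - x - d *: u)).
have g0 : 0 <=v g by exact: (posp_ge0 BL).
pose w := meet (meet (a 0%N) (b n)) g.
have w0 : 0 <=v w by apply: (meet_ge0 BL) => //; exact: (meet_ge0 BL).
have du0 : 0 <=v d *: u by rewrite -(scaler0 _ d); apply: (bl_scale BL) => //; exact: ltW.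
have ws : w <=v \sum_(j < n.+1) s j.
  apply: (meet_chain BL) => j jn.
    exact: (@lev_sum1 n.+1 (fun j => s j) (Ordinal (jn : (j < n.+1)%N)) (fun j => s0 j)).
  have h1 := joinl (b j) (a j.+1); have h2 := joinr (b j) (a j.+1).
  have h3 := b0 j; have h4 := a0 j.+1.
  have h5 : c j *: u - x <=v b j by exact: (le_posp BL).
  have h6 : y - c j.+1 *: u <=v a j.+1 by exact: (le_posp BL).
  have e : c j.+1 = c j + d by rewrite /c -natr1; lra.
  by rewrite e in h6; apply: (posp_le BL); vlra BL.
exists (meet w u); split.
- exact: (meet_ge0 BL).
- exact: (meetr BL).
- apply: (letr (y := \sum_(j < n.+1) 2 *: s j)).
    rewrite -scaler_sumr; apply: (bl_scale BL) => //.
    by apply: letr ws; exact: (meetl BL).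
  apply: lev_sum => j; apply: (labs_gap BL); first exact: (meetl BL).
  by rewrite opprB; exact: (meetr BL).
(* As c_0 = - K and c_n = K, a_0 or b_n falls below u only where y < - (K - 1) u or x > (K - 1)
   u. *)
have tail y' t : - y' - (K - 1) *: u <=v abs y' - (K - 1) *: u ->
    u - t <=v - y' - (K - 1) *: u -> meet u (posp (u - t)) <=v K^-1 *: abs y'.
  move=> h1 h2; apply: letr (meet_tail BL y' K1 u0); apply: (meetS BL) => //.
  apply: (posp_le BL); last exact: (posp_ge0 BL).
  by apply: letr (le_posp BL _); exact: letr h1.
have ta : meet u (posp (u - a 0%N)) <=v K^-1 *: abs y.
  apply: tail; first by have h := leN_labs BL y; vlra BL.
  have h : y - c 0%N *: u <=v a 0%N by exact: (le_posp BL).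
  by rewrite /c mul0r addr0 in h; vlra BL.
have tb : meet u (posp (u - b n)) <=v K^-1 *: abs x.
  rewrite -(labsN BL); apply: tail; first by have h := leN_labs BL (- x); vlra BL.
  have h : c n *: u - x <=v b n by exact: (le_posp BL).
  by rewrite /c nd in h; vlra BL.
(* Restricting p to q costs only the part where q stays below u. *)
have trunc p q : 0 <=v q -> meet u p <=v meet (meet p q) u + meet u (posp (u - q)).
  move=> q0; set t := meet u (posp _).
  have h1 := meetl BL u p; have h2 := meetr BL u p.
  have t0 : 0 <=v t by apply: (meet_ge0 BL) => //; exact: (posp_ge0 BL).
  have h3 : u <=v meet u q + t.
    apply: letr (meetD_le BL q0 (posp_ge0 BL (u - q)) u0).
    by apply: (meetP BL) => //; have h := le_posp BL (u - q); vlra BL.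
  have h4 := meetr BL u q; have h5 := meetl BL u q.
  have h : meet u p - t <=v meet (meet p q) u.
    by apply: (meetP BL); [apply: (meetP BL)|]; vlra BL.
  vlra BL.
have h1 := trunc g _ (a0 0%N); have h2 := trunc (meet g (a 0%N)) _ (b0 n).
have h3 : meet u (meet g (a 0%N)) = meet (meet g (a 0%N)) u by rewrite (meetC BL).
rewrite -h3 in h1.
have h4 : meet (meet (meet g (a 0%N)) (b n)) u <=v meet w u.
  apply: (meetS BL) => //; apply: (meetP BL); last first.
    by apply: letr (meetl BL _ _) (meetl BL _ _).
  apply: (meetS BL) => //; exact: (meetr BL).
have gu := meetP BL (meetl BL u g) (meetr BL u g).
have h5 : meet u g <=v meet w u + K^-1 *: abs x + K^-1 *: abs y by vlra BL.
have h6 : posp (y - x) <=v g + (g + d *: u).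
  have k1 : (1 / 2) *: (y - x - d *: u) <=v g by exact: (le_posp BL).
  by apply: (posp_le BL); vlra BL.
have gd0 : 0 <=v g + d *: u by vlra BL.
have h7 := meetD_le BL g0 gd0 u0; have h8 := meetD_le BL g0 du0 u0.
have h9 := meetr BL u (d *: u).
have h10 := meetS BL (lexx u) h6.
vlra BL.
Qed.

Lemma archimedean_lev z v : (forall k : nat, k%:R *: z <=v v) -> z <=v 0.
Proof.
move=> h; have [_ qZ] := norm_posp_sublinear BL.
have hk (k : nat) : k%:R * `|posp z| <= `|posp v|.
  rewrite -qZ//; apply: (norm_mono BL); first exact: (posp_ge0 BL).
  apply: (posp_le BL); last exact: (posp_ge0 BL).
  by apply: letr (h k) _; exact: (le_posp BL).
have : `|posp z| = 0.
  apply/eqP; rewrite eq_le normr_ge0 andbT leNgt; apply/negP => z0.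
  have := archi_boundP (divr_ge0 (normr_ge0 (posp v)) (ltW z0)).
  by rewrite ltr_pdivrMr// ltNge hk.
by move/eqP; rewrite normr_eq0 => /eqP <-; exact: (le_posp BL).
Qed.

Lemma lev_lim (x : nat -> V) l y :
  (forall e : R, 0 < e -> exists N, forall n, (N <= n)%N -> `|x n - l| < e) ->
  (exists N, forall n, (N <= n)%N -> y <=v x n) -> y <=v l.
Proof.
move=> xl [N0 yx]; suff h : `|posp (y - l)| = 0.
  have := le_posp BL (y - l); move/eqP: h; rewrite normr_eq0 => /eqP -> h.
  vlra BL.
apply/eqP; rewrite eq_le normr_ge0 andbT; apply/ler_addgt0Pr => e e0.
have [N hN] := xl e e0; rewrite add0r.
apply: ltW; apply: le_lt_trans (hN (maxn N N0) (leq_maxl _ _)).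
apply: le_trans (norm_posp_le BL _); apply: (norm_mono BL); first exact: (posp_ge0 BL).
apply: (posp_le BL); last exact: (posp_ge0 BL).
have h := yx _ (leq_maxr N N0); have h2 := le_posp BL (x (maxn N N0) - l).
vlra BL.
Qed.

Hypothesis OC : order_continuous le.

(** No supremum of (x_n) is at hand, so order continuity is applied to the net y - x_n over pairs of
    an upper bound y and an index n. If z lies below this net, then y - z is again an upper bound;
    iterating, k z <= u - x_0 for all k, and z <= 0. *)
Lemma monotone_cauchy (x : nat -> V) u : (forall n, x n <=v x n.+1) ->
  (forall n, x n <=v u) ->
  forall e : R, 0 < e -> exists N, forall n, (N <= n)%N -> `|x n - x N| < e.
Proof.
move=> xS xu e e0.
have xmono n m : (n <= m)%N -> x n <=v x m.
  by move=> /subnK <-; elim: (m - n)%N => // k IH; apply: letr IH _; exact: xS.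
pose I := {p : V * nat | forall n, x n <=v p.1}.
pose leI (p q : I) := (sval q).1 <=v (sval p).1 /\ ((sval p).2 <= (sval q).2)%N.
pose X (p : I) := (sval p).1 - x (sval p).2.
have [] := OC (leI := leI) (x := X) _ _ _ _ _ _ (e := e / 2).
- by move=> p; split.
- move=> p q r [h1 h2] [h3 h4]; split; first exact: letr h1.
  exact: leq_trans h4.
- move=> p q; have hpq n : x n <=v (meet (sval p).1 (sval q).1, maxn (sval p).2 (sval q).2).1.
    by apply: (meetP BL); [exact: (svalP p)|exact: (svalP q)].
  exists (exist _ _ hpq); split; split=> /=.
  + exact: (meetl BL).
  + exact: leq_maxl.
  + exact: (meetr BL).
  + exact: leq_maxr.
- move=> p q [h1 /xmono h2]; rewrite /X; vlra BL.
- move=> p; have h := svalP p (sval p).2; rewrite /X; vlra BL.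
- move=> z hz; apply: (@archimedean_lev _ (u - x 0%N)) => k.
  have hk (m : nat) n : x n <=v u - m%:R *: z.
    elim: m n => [|m IH] n; first by have h := xu n; vlra BL.
    have h := hz (exist (fun p : V * nat => forall n, x n <=v p.1) (_, n) IH).
    by rewrite /X/= in h; rewrite -natr1; vlra BL.
  have h := hk k 0%N; vlra BL.
- by rewrite divr_gt0.
move=> [[y N] hy] h; exists N => n Nn.
have h1 := h (exist _ (y, n) hy) (conj (lexx y) Nn).
have h2 := h (exist _ (y, N) hy) (conj (lexx y) (leqnn N)).
have -> : x n - x N = (y - x N) - (y - x n) by rewrite opprB [RHS]addrC addrA subrK.
by apply: le_lt_trans (ler_normB _ _) _; rewrite /X/= in h1 h2; lra.
Qed.
End OrderContinuous.

(** * Strictly positive functionals and convex minimization *)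

Lemma geometric_limit (R : realType) (V : completeNormedModType R) (x : nat -> V) (C : R) :
  (forall n, `|x n.+1 - x n| <= C * 2^-1 ^+ n) ->
  exists l, (forall n, `|x n - l| <= 2 * C * 2^-1 ^+ n) /\
    forall e : R, 0 < e -> exists N, forall n, (N <= n)%N -> `|x n - l| < e.
Proof.
move=> hx; have C0 : 0 <= C.
  by have := hx 0%N; rewrite expr0 mulr1; apply: le_trans; exact: normr_ge0.
have p0 n : 0 < 2^-1 ^+ n :> R by rewrite exprn_gt0// invr_gt0.
have hk n k : `|x (n + k)%N - x n| <= 2 * C * (2^-1 ^+ n - 2^-1 ^+ (n + k)).
  elim: k => [|k IH]; first by rewrite addn0 !subrr normr0 mulr0.
  rewrite addnS; have := hx (n + k)%N; rewrite exprS => h.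
  have := ler_distD (x (n + k)%N) (x (n + k).+1) (x n); nra.
have hk2 n m : (n <= m)%N -> `|x m - x n| <= 2 * C * 2^-1 ^+ n.
  move=> /subnKC <-; apply: le_trans (hk n (m - n)%N) _.
  by have := p0 (n + (m - n))%N; have := p0 n; nra.
have [|l xl] := @cauchy_converges _ _ x.
  move=> e e0; have e1 : 0 < e / (2 * C + 1) by rewrite divr_gt0//; nra.
  have [N hN] := half_expr_lt e1; exists N => n Nn.
  apply: le_lt_trans (hk2 _ _ Nn) _; have := hN N (leqnn N).
  by rewrite ltr_pdivlMr; [have := p0 N; nra|nra].
exists l; split=> // n; apply/ler_addgt0Pr => e e0; have [N hN] := xl e e0.
have := ler_distD (x (maxn N n)) (x n) l; rewrite (distrC (x n) (x (maxn N n))).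
by have := hk2 _ _ (leq_maxr N n); have := hN _ (leq_maxl N n); lra.
Qed.

Section StrictFunctional.
Variables (R : realType) (V : completeNormedModType R).
Variables (le : V -> V -> Prop) (join : V -> V -> V).
Hypotheses (BL : is_banach_lattice le join) (OC : order_continuous le).

Local Notation "x '<=v' y" := (le x y) (at level 70).
Local Notation meet := (lmeet join).
Local Notation abs := (labs join).
Local Notation posp := (posp join).

Let lexx := bl_refl BL.
Let letr := bl_trans BL.
Let joinl := bl_join_ub_l BL.
Let joinr := bl_join_ub_r BL.
Let joinP := bl_join_lub BL.

(** In contrast to [posfun] the bound C is arbitrary, so that sums of norming functionals stay in
    the class. *)
Definition poslin (phi : V -> R) := [/\ linfun_R phi,
  forall x, 0 <=v x -> 0 <= phi x & exists C, forall x, phi x <= C * `|x|].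

Lemma posfun_poslin phi : posfun le phi -> poslin phi.
Proof. by case=> h1 h2 h3; split=> //; exists 1 => x; rewrite mul1r. Qed.

Lemma poslinD phi psi : poslin phi -> poslin psi -> poslin (fun x => phi x + psi x).
Proof.
move=> [l1 p1 [C1 b1]] [l2 p2 [C2 b2]]; split.
- by move=> a x y; rewrite l1 l2; lra.
- by move=> x x0; rewrite addr_ge0 ?p1 ?p2.
- by exists (C1 + C2) => x; rewrite mulrDl lerD.
Qed.

Lemma poslin_le phi x y : poslin phi -> x <=v y -> phi x <= phi y.
Proof. by case=> hl hp _ /(lev_sub BL)/hp; rewrite linRB// subr_ge0. Qed.

(* If it failed, one could find z_n in [0, u] of norm > e and functionals phi_n
   norming them with phi_m z_n <= 2^-n for m < n. The suprema y_n of the tails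
   of (z_n) decrease, hence form a norm Cauchy sequence; but phi_n y_n > e while
   phi_n y_m is small for large m. *)
Lemma strictly_positive_on_interval u (e : R) : 0 <=v u -> 0 < e ->
  exists phi (d : R), [/\ poslin phi, 0 < d &
    forall z, 0 <=v z -> z <=v u -> phi z <= d -> `|z| <= e].
Proof.
move=> u0 e0; apply: contrapT => hN.
(* The hypothesis on [p.1] sits inside the existential so that [choice] gives a total function; for
   other p any z serves. *)
have hz (p : (V -> R) * nat) : exists z, poslin p.1 ->
    [/\ 0 <=v z, z <=v u, p.1 z <= 2^-1 ^+ p.2 & e < `|z|].
  apply: contrapT => hz; apply: hN; exists p.1, (2^-1 ^+ p.2); split.
  - by apply: contrapT => hp; apply: hz; exists 0.
  - by rewrite exprn_gt0// invr_gt0.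
  - move=> z z0 zu pz; rewrite leNgt; apply/negP => ez; apply: hz.
    by exists z.
have [Z hZ] := choice hz.
have hF0 z : exists phi, posfun le phi /\ phi z = `|posp z|.
  by have [phi ? ?] := posfun_norming BL z; exists phi.
have [F hF] := choice hF0.
(* The state pairs the sum of the functionals chosen so far with the index. All of them being
   positive, smallness of the sum at z_n bounds phi_m z_n for every m < n. *)
pose step (p : (V -> R) * nat) := ((fun x => p.1 x + F (Z p) x), p.2.+1).
pose st n := iter n step (fun=> 0, 0%N).
have st2 n : (st n).2 = n by elim: n => //= n ->.
have stp n : poslin (st n).1.
  elim: n => [|n IH]/=.
    split=> //; first by move=> a x y; rewrite mulr0 addr0.
    by exists 0 => x; rewrite mul0r.
  by apply: poslinD => //; apply: posfun_poslin; case: (hF (Z (st n))).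
pose z n := Z (st n); pose phi n := F (z n).
have zP n := hZ (st n) (stp n).
have z0 n : 0 <=v z n by case: (zP n).
have zu n : z n <=v u by case: (zP n).
have ze n : e < `|z n| by case: (zP n).
have hphi n : posfun le (phi n) by case: (hF (z n)).
have phip n : poslin (phi n) by exact: posfun_poslin.
have phizn n : phi n (z n) = `|z n|.
  rewrite /phi (hF (z n)).2; congr `|_|; apply: (bl_antisym BL); last exact: (le_posp BL).
  exact: (posp_le BL).
have phile m n x : (m < n)%N -> 0 <=v x -> phi m x <= (st n).1 x.
  move=> mn x0; elim: n mn => // n IH; rewrite ltnS leq_eqVlt => /predU1P[->|mn].
    rewrite /=; have [_ h _] := stp n; have := h _ x0.
    by rewrite /phi /z; lra.
  apply: le_trans (IH mn) _ => /=; rewrite lerDl; have [_ h _] := hphi n; exact: h.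
have phiz m n : (m < n)%N -> phi m (z n) <= 2^-1 ^+ n.
  by move=> mn; apply: le_trans (phile _ _ _ mn (z0 n)) _; have [_ _ + _] := zP n; rewrite st2.
pose S n := fix S k := if k is k'.+1 then join (S k') (z (n + k)%N) else z n.
have SS n k : S n k.+1 = join (S n k) (z (n + k.+1)%N) by [].
have Su n k : S n k <=v u by elim: k => [|k IH]; [exact: zu|rewrite SS; exact: joinP].
have Sz n k i : (i <= k)%N -> z (n + i)%N <=v S n k.
  elim: k => [|k IH]; first by rewrite leqn0 => /eqP ->; rewrite addn0; exact: lexx.
  rewrite leq_eqVlt ltnS => /predU1P[->|/IH h]; first by rewrite SS; exact: joinr.
  by apply: letr h _; exact: joinl.
have Slub n k t : (forall i, (i <= k)%N -> z (n + i)%N <=v t) -> S n k <=v t.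
  elim: k => [|k IH] h; first by have := h 0%N isT; rewrite addn0.
  by rewrite SS; apply: joinP; [apply: IH => i ik; exact: h (leqW ik)|exact: h].
have S0 n k : 0 <=v S n k by apply: letr (Sz n k 0%N isT).
have phiS m n k : (m < n)%N -> phi m (S n k) <= 2 * 2^-1 ^+ n - 2^-1 ^+ (n + k).
  move=> mn; elim: k => [|k IH].
    by have := phiz m n mn; rewrite addn0 /=; lra.
  have hS : S n k.+1 <=v S n k + z (n + k.+1)%N.
    have h1 := S0 n k; have h2 := z0 (n + k.+1)%N.
    by rewrite SS; apply: joinP; vlra BL.
  have := posfun_le BL (hphi m) hS; rewrite (posfunE (hphi m)).
  have := phiz m (n + k.+1)%N (leq_trans mn (leq_addr _ _)).
  by rewrite addnS exprS; lra.
have hy0 n : exists l, forall d : R, 0 < d ->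
    exists N, forall k, (N <= k)%N -> `|S n k - l| < d.
  apply: cauchy_converges.
  by apply: (monotone_cauchy BL OC (u := u)) => // k; rewrite SS; exact: joinl.
have [y hy] := choice hy0.
have ySn n k : S n k <=v y n.
  apply: (lev_lim BL (hy n)); exists k => j /subnK <-.
  elim: (j - k)%N => [|i IH]; first exact: lexx.
  by apply: letr IH _; rewrite addSn SS; exact: joinl.
have yub n t : (forall k, S n k <=v t) -> y n <=v t.
  move=> h; suff h' : - t <=v - y n by vlra BL.
  apply: (lev_lim BL (x := fun k => - S n k)); last first.
    by exists 0%N => k _; have h1 := h k; vlra BL.
  move=> d d0; have [N hN'] := hy n d d0; exists N => k Nk.
  by rewrite -opprD normrN; exact: hN'.
have yS n : y n.+1 <=v y n.
  apply: yub => k; apply: Slub => i ik; apply: letr (ySn n i.+1).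
  by rewrite addSnnS; exact: Sz.
have y0 n : 0 <=v y n by apply: letr (ySn n 0%N).
have phiy m n : (m < n)%N -> phi m (y n) <= 2 * 2^-1 ^+ n.
  move=> mn; apply/ler_addgt0Pr => d d0; have [N /(_ N (leqnn N)) h] := hy n d d0.
  have p0 : 0 < 2^-1 ^+ (n + N) :> R by rewrite exprn_gt0// invr_gt0.
  have [hl _ /(_ (y n - S n N))] := hphi m; rewrite linRB// distrC.
  by have := phiS m n N mn; lra.
(* [monotone_cauchy] wants an increasing sequence, hence the signs. With this N and a large n, e <
   phi_N y_N <= |y_N - y_n| + phi_N y_n < e/2 + e/4. *)
have [N hNy] : exists N, forall n, (N <= n)%N -> `|(- y n) - (- y N)| < e / 2.
  apply: (monotone_cauchy BL OC (u := 0)); last by rewrite divr_gt0.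
    by move=> n; have h := yS n; vlra BL.
  by move=> n; have h := y0 n; vlra BL.
have [M hM] : exists M, forall n, (M <= n)%N -> 2^-1 ^+ n < e / 8.
  by apply: half_expr_lt; rewrite divr_gt0.
pose n := (maxn N.+1 M).
have := hM n (leq_maxr _ _); have := phiy N n (leq_maxl _ _).
have := hNy n (ltnW (leq_maxl _ _)); rewrite opprK addrC.
have [hl _ /(_ (y N - y n))] := hphi N; rewrite linRB//.
have := posfun_le BL (hphi N) (ySn N 0%N); rewrite /= phizn.
by have := ze N; lra.
Qed.

(* A convex functional whose failure of strict convexity between x and y
   controls |x - y| /\ u. *)
Lemma uniformly_convex_functional u (C e : R) : 0 <=v u -> 0 <= C -> 0 < e ->
  exists (G : V -> R) (eta B : R), [/\ 0 < eta,
    forall x, `|x| <= C -> 0 <= G x <= B &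
    forall x y, `|x| <= C -> `|y| <= C ->
      G x + G y - 2 * G ((1 / 2) *: (x + y)) <= eta ->
      `|meet u (abs (x - y))| <= e].
Proof.
move=> u0 C0 e0; have e16 : 0 < e / 16 by rewrite divr_gt0.
have [phi [dlt [hphi dlt0 hd]]] := strictly_positive_on_interval u0 e16.
have [hl hp [D hD]] := hphi.
(* Each of the three terms of [gap_estimate] gets norm at most e/8: 2 z by the choice of [dlt], the
   tail by K, since K^-1 C <= e/32, and the mesh d u by n. *)
pose K := 1 + 1 + 32 * C / e.
have Ce0 : 0 <= C / e by rewrite divr_ge0// ltW.
have K1 : 1 < K by rewrite /K -mulrA; lra.
have K0 : 0 < K by lra.
pose n := (Num.bound (16 * K * (`|u| + 1) / e)).+1.
have n0 : (0 : R) < n%:R by rewrite ltr0n.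
pose d := 2 * K / n%:R.
have d0 : 0 < d by rewrite divr_gt0// mulr_gt0.
have nd : n%:R * d = 2 * K by rewrite /d mulrC divfK// gt_eqF.
pose c (j : nat) := - K + j%:R * d.
pose G x := \sum_(j < n.+1) phi (abs (x - c j *: u)).
have phiabs x : 0 <= phi (abs x) <= `|D| * `|x|.
  apply/andP; split; first by apply: hp; exact: (labs_ge0 BL).
  apply: (le_trans (hD _)).
  by rewrite (norm_labs BL); apply: ler_wpM2r => //; exact: ler_norm.
exists G, (2 * dlt), (\sum_(j < n.+1) `|D| * (C + `|c j| * `|u|)); split.
- by rewrite mulr_gt0.
- move=> x xC; apply/andP; split; first by apply: sumr_ge0 => j _; case/andP: (phiabs (x - c j *: u)).
  apply: ler_sum => j _; case/andP: (phiabs (x - c j *: u)) => _ h.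
  apply: le_trans h _; apply: ler_wpM2l => //; apply: le_trans (ler_normB _ _) _.
  by rewrite normrZ lerD2r.
have Gap x y : phi (\sum_(j < n.+1) (abs (x - c j *: u) + abs (y - c j *: u)
       - abs (x - c j *: u + (y - c j *: u)))) = G x + G y - 2 * G ((1 / 2) *: (x + y)).
  rewrite linR_sum// /G mulr_sumr -big_split/= -sumrB; apply: eq_bigr => j _.
  rewrite linRB// linRD//; congr (_ - _); rewrite -linRZ// -(labsZ BL)//.
  congr (phi (abs _)); rewrite scalerBr !scalerA.
  rewrite (_ : 2 * (1 / 2) = 1 :> R); last by lra.
  by rewrite scale1r; move: (c j) => k; rewrite mulrC mulr_natr mulr2n scalerDl addrACA opprD.
(* [gap_estimate] controls only (y - x)^+; the defect of G is symmetric, so exchanging x and y gives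
   the other half of |x - y|. *)
have half x y : `|x| <= C -> `|y| <= C ->
    G x + G y - 2 * G ((1 / 2) *: (x + y)) <= 2 * dlt ->
    `|meet u (posp (y - x))| <= e / 2.
  move=> xC yC hG; have [z [z0 zu hz hm]] := gap_estimate BL x y u0 K1 d0 nd.
  have := poslin_le hphi hz; rewrite Gap linRZ// => hz2.
  have ze : `|z| <= e / 16 by apply: hd => //; lra.
  have m0 : 0 <=v meet u (posp (y - x)) by apply: (meet_ge0 BL) => //; exact: (posp_ge0 BL).
  apply: le_trans (norm_mono BL m0 hm) _.
  have kK : K^-1 * C <= e / 32.
    rewrite mulrC ler_pdivrMr// /K !mulrDr mulrA.
    have -> : e / 32 * (32 * C) / e = C by field; rewrite gt_eqF.
    by rewrite mulr1; lra.
  have kd : d * `|u| <= e / 8.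
    rewrite /d mulrAC ler_pdivrMr//.
    have := archi_boundP (_ : 0 <= 16 * K * (`|u| + 1) / e).
    have h0 : 0 <= 16 * K * (`|u| + 1) by have := normr_ge0 u; nra.
    rewrite (divr_ge0 h0 (ltW e0)) => /(_ isT).
    rewrite ltr_pdivrMr// => h.
    have -> : n%:R = (Num.bound (16 * K * (`|u| + 1) / e))%:R + 1 :> R.
      by rewrite natr1.
    by lra.
  have Ki : 0 <= K^-1 by rewrite invr_ge0 ltW.
  set A := (2 * K^-1) *: (abs x + abs y).
  have nA : `|A| <= 4 * (K^-1 * C).
    rewrite /A normrZ ger0_norm; last by rewrite mulr_ge0.
    have := ler_normD (abs x) (abs y); rewrite !(norm_labs BL) => hn; nra.
  have nz : `|2 *: z| = 2 * `|z| by rewrite normrZ ger0_norm.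
  have nu : `|d *: u| = d * `|u| by rewrite normrZ ger0_norm// ltW.
  by have := ler_normD (2 *: z + A) (d *: u); have := ler_normD (2 *: z) A; lra.
move=> x y xC yC hG; have h1 := half x y xC yC hG.
have h2 : `|meet u (posp (x - y))| <= e / 2.
  by apply: half => //; rewrite [y + x]addrC; lra.
have ab0 := labs_ge0 BL (x - y).
apply: le_trans (norm_mono BL (meet_ge0 BL u0 ab0) _) _; last first.
  apply: le_trans (ler_normD _ _) _; last first.
    by apply: le_trans (lerD h2 h1) _; lra.
rewrite (labsE BL) opprB; apply: (meetD_le BL) => //; exact: (posp_ge0 BL).
Qed.

(** Passing to smaller sets raises the infimum [I] of G, which stays below B. Take A1 within eta/4
    of the supremum, a near-minimizer x of A1, and a near-minimizer y of a subset A2 separated from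
    x. Their midpoint lies in A1, where G is at least I A1, so the convexity defect is below 3
    eta/4. *)
Lemma small_meet_difference (AA : set (set V)) (C theta : R) :
  (forall A x, AA A -> A x -> `|x| <= C) ->
  (forall A, AA A -> A !=set0) ->
  (forall A x y, AA A -> A x -> A y -> A ((1 / 2) *: (x + y))) ->
  (forall A x, AA A -> A x -> exists A', [/\ AA A', A' `<=` A &
     forall y, A' y -> theta <= `|x - y|]) ->
  forall A u (e : R), AA A -> 0 <=v u -> 0 < e ->
  exists x y, [/\ A x, A y, theta <= `|x - y| & `|meet u (abs (x - y))| <= e].
Proof.
move=> AC A0 Amid Asep A u e hA u0 e0.
have C0 : 0 <= C by have [x Ax] := A0 _ hA; apply: le_trans (AC _ _ hA Ax).
have [G [eta [B [eta0 GB hG]]]] := uniformly_convex_functional u0 C0 e0.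
pose I A' := inf [set G x | x in A'].
have Iset A' : AA A' -> [set G x | x in A'] !=set0.
  by move=> /A0[x hx]; exists (G x), x.
have Ilb A' : AA A' -> has_lbound [set G x | x in A'].
  by move=> hA'; exists 0 => _ [x A'x <-]; case/andP: (GB x (AC _ _ hA' A'x)).
have Ile A' x : AA A' -> A' x -> I A' <= G x.
  by move=> hA' A'x; apply: ge_inf; [exact: Ilb|exists x].
pose SS := [set I A' | A' in [set A' | AA A' /\ A' `<=` A]].
have S0 : SS !=set0 by exists (I A); exists A => //; split.
have Sub : has_ubound SS.
  exists B => _ [A' [hA' _] <-]; have [x A'x] := A0 _ hA'.
  by apply: le_trans (Ile _ _ hA' A'x) _; case/andP: (GB x (AC _ _ hA' A'x)).
have eta4 : 0 < eta / 4 by rewrite divr_gt0.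
have near A' : AA A' -> exists2 x, A' x & G x < I A' + eta / 4.
  move=> hA'; have := @inf_lt _ _ (I A' + eta / 4) (Iset _ hA').
  by rewrite ltrDl eta4 => /(_ isT)[_ [x A'x <-] h]; exists x.
have [_ [A1 [hA1 A1A] <-] hI1] : exists2 s, SS s & sup SS - eta / 4 < s.
  by apply: sup_gt => //; rewrite ltrBlDr ltrDl.
have Isup A' : AA A' -> A' `<=` A -> I A' <= sup SS.
  by move=> hA' A'A; apply: sup_upper_bound; [split|exists A'].
have [x A1x hx] := near _ hA1.
have [A2 [hA2 A21 hsep]] := Asep _ _ hA1 A1x.
have [y A2y hy] := near _ hA2.
exists x, y; split; [exact: (A1A _ A1x)|exact: (A1A _ (A21 _ A2y))|exact: (hsep _ A2y)|].
apply: hG; [exact: (AC _ _ hA1 A1x)|exact: (AC _ _ hA2 A2y)|].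
have := Ile _ _ hA1 (Amid _ _ _ hA1 A1x (A21 _ A2y)).
have := Isup _ hA1 A1A; have := Isup _ hA2 (subset_trans A21 A1A).
by lra.
Qed.
End StrictFunctional.

(** * Almost disjoint sequences *)

Section Disjointification.
Variables (R : realType) (V : completeNormedModType R).
Variables (le : V -> V -> Prop) (join : V -> V -> V).
Hypothesis BL : is_banach_lattice le join.

Local Notation "x '<=v' y" := (le x y) (at level 70).
Local Notation meet := (lmeet join).
Local Notation abs := (labs join).
Local Notation posp := (posp join).

Let lexv := bl_refl BL.
Let letr := bl_trans BL.

Lemma meet_scale0 (a b : R) x y : 0 <= a -> 0 <= b -> 0 <=v x -> 0 <=v y ->
  meet x y = 0 -> meet (a *: x) (b *: y) = 0.
Proof.
move=> a0 b0 p0 n0 xy.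
have scale0 (c : R) z : 0 <= c -> 0 <=v z -> 0 <=v c *: z.
  by move=> c0 z0; rewrite -(scaler0 _ c); exact: (bl_scale BL).
apply: (bl_antisym BL); last by apply: (meet_ge0 BL); exact: scale0.
(* c exceeds both a and b and is positive even if both vanish. *)
set t := meet _ _; pose c := a + b + 1; have c0 : 0 < c by rewrite /c; lra.
have ci : 0 <= c^-1 by rewrite invr_ge0 ltW.
have ta : t <=v c *: x.
  apply: letr (meetl BL _ _) _; apply/(lev_sub BL); rewrite -scalerBl.
  by apply: scale0 => //; rewrite /c; lra.
have tb : t <=v c *: y.
  apply: letr (meetr BL _ _) _; apply/(lev_sub BL); rewrite -scalerBl.
  by apply: scale0 => //; rewrite /c; lra.
have h : c^-1 *: t <=v 0.
  rewrite -xy.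
  apply: (meetP BL).
    by have := bl_scale BL ci ta; rewrite scalerA mulVf ?scale1r// gt_eqF.
  by have := bl_scale BL ci tb; rewrite scalerA mulVf ?scale1r// gt_eqF.
have := bl_scale BL (ltW c0) h.
by rewrite scalerA mulfV ?scale1r ?scaler0// gt_eqF.
Qed.

Lemma sub_posp_sub x v : 0 <=v x -> 0 <=v v ->
  0 <=v x - posp (x - v) /\ x - posp (x - v) <=v meet v x.
Proof.
move=> x0 v0; have h : posp (x - v) <=v x by apply: (posp_le BL) => //; vlra BL.
split; first by vlra BL.
have h1 := posp_ge0 BL (x - v); have h2 := le_posp BL (x - v).
by apply: (meetP BL); vlra BL.
Qed.

(* Subtracting from w_n^+ and w_n^- a large multiple of the previous |w_i| and
   a small multiple of the later ones makes the sequence disjoint. *)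
Lemma disjoint_approximation (w : nat -> V) (C : R) : (forall n, `|w n| <= C) ->
  (forall n, `|meet (2 ^+ n *: \sum_(i < n) abs (w i)) (abs (w n))| <= 2^-1 ^+ n) ->
  exists2 f, disjoint_seq join f &
    forall n, `|w n - f n| <= 2 * (1 + C) * 2^-1 ^+ n.
Proof.
move=> wC hw.
have C0 : 0 <= C by apply: le_trans (wC 0%N).
have h0 n : 0 < 2^-1 ^+ n :> R by rewrite exprn_gt0// invr_gt0.
have p0 n : 0 < 2 ^+ n :> R by rewrite exprn_gt0.
have hp n : 2^-1 ^+ n * 2 ^+ n = 1 :> R by rewrite -exprMn mulVf ?expr1n// pnatr_eq0.
have scale0 (c : R) x : 0 <= c -> 0 <=v x -> 0 <=v c *: x.
  by move=> c0 x0; rewrite -(scaler0 _ c); exact: (bl_scale BL).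
have aw0 n := labs_ge0 BL (w n).
pose P n := \sum_(i < n) 2^-1 ^+ i *: abs (w i).
have PS n : P n.+1 = P n + 2^-1 ^+ n *: abs (w n) by rewrite /P big_ord_recr.
have [l [Pl1 Pl2]] : exists l, (forall n, `|P n - l| <= 2 * C * 2^-1 ^+ n) /\
    forall e : R, 0 < e -> exists N, forall n, (N <= n)%N -> `|P n - l| < e.
  apply: geometric_limit => n.
  rewrite PS addrC addKr normrZ ger0_norm ?(ltW (h0 n))// mulrC (norm_labs BL).
  by rewrite ler_pM2r.
have Pmono n m : (n <= m)%N -> P n <=v P m.
  move=> /subnKC <-; elim: (m - n)%N => [|k IH]; first by rewrite addn0.
  rewrite addnS PS; have h := scale0 _ _ (ltW (h0 (n + k)%N)) (aw0 (n + k)%N).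
  vlra BL.
have Ple n : P n <=v l by apply: (lev_lim BL Pl2); exists n => m; exact: Pmono.
(* [r n] is the tail of the series of 2^-i |w_i| over i > n, and [S n] the large multiple of the
   earlier terms. *)
pose r n := l - P n.+1; pose S n := 2 ^+ n *: \sum_(i < n) abs (w i).
pose v n := S n + r n.
have r0 n : 0 <=v r n by exact: ((lev_sub BL _ _).1 (Ple n.+1)).
have s0 n : 0 <=v \sum_(i < n) abs (w i).
  elim/big_ind : _ => // x y x0 y0; rewrite -(addr0 0); exact: (lev_addv BL).
have S0 n : 0 <=v S n by apply: scale0 => //; exact: ltW.
have v0 n : 0 <=v v n by rewrite -(addr0 0); apply: (lev_addv BL).
have rn n : `|r n| <= C * 2^-1 ^+ n.
  by rewrite /r distrC; apply: le_trans (Pl1 _) _; rewrite exprS; lra.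
have vlow n m : (n < m)%N -> 2^-1 ^+ m *: abs (w m) <=v v n.
  move=> nm; have h1 := Ple m.+1; rewrite PS in h1; have h2 := Pmono _ _ nm.
  have h3 := S0 n; rewrite /v /r; vlra BL.
have vhigh n m : (n < m)%N -> 2 ^+ m *: abs (w n) <=v v m.
  move=> nm.
  have h1 : abs (w n) <=v \sum_(i < m) abs (w i).
    exact: (@lev_sum1 _ _ _ _ BL m (fun j => abs (w j)) (Ordinal nm) (fun j => aw0 j)).
  have h2 : 2 ^+ m *: abs (w n) <=v S m by apply: (bl_scale BL) => //; exact: ltW.
  have h3 := r0 m; rewrite /v; vlra BL.
(* Truncating w^+ and w^- separately keeps the sign and leaves errors p - (p - v_n)^+, which lie
   below v_n /\ p. *)
pose f n := posp (posp (w n) - v n) - posp (posp (- w n) - v n).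
have absf n : abs (f n) <=v 2 *: posp (abs (w n) - v n).
  have hm a b : a <=v b -> posp (a - v n) <=v posp (b - v n).
    move=> ab; apply: (posp_le BL); last exact: (posp_ge0 BL).
    by apply: letr (le_posp BL _); vlra BL.
  have h1 := hm _ _ (posp_le_labs BL (w n)).
  have h2 := hm _ _ (posp_le_labs BL (- w n)); rewrite (labsN BL) in h2.
  have h3 := posp_ge0 BL (posp (w n) - v n).
  have h4 := posp_ge0 BL (posp (- w n) - v n).
  by rewrite /f; apply: (labs_le BL); vlra BL.
(* |f_n| and |f_m| lie below multiples of the positive and the negative part of the single vector
   |w_n| - 2^-m |w_m|. *)
have disj n m : (n < m)%N -> meet (abs (f n)) (abs (f m)) = 0.
  move=> nm; apply: (bl_antisym BL); last by apply: (meet_ge0 BL); exact: (labs_ge0 BL).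
  pose z := abs (w n) - 2^-1 ^+ m *: abs (w m).
  rewrite -(@meet_scale0 2 (2 * 2 ^+ m) (posp z) (posp (- z)))// ?mulr_ge0// ?(ltW (p0 m))//;
    try exact: (posp_ge0 BL); last exact: (meet_posp_posn BL).
  apply: (meetS BL); first apply: letr (absf n) _.
    apply: (bl_scale BL) => //; apply: (posp_le BL); last exact: (posp_ge0 BL).
    by apply: letr (le_posp BL _); have h := vlow _ _ nm; rewrite /z; vlra BL.
  apply: letr (absf m) _; rewrite -scalerA; apply: (bl_scale BL) => //.
  apply: (posp_le BL); last by apply: scale0; [exact: ltW|exact: (posp_ge0 BL)].
  have h := bl_scale BL (ltW (p0 m)) (le_posp BL (- z)).
  apply: letr h; rewrite /z opprB scalerBr scalerA mulrC hp scale1r.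
  have h := vhigh _ _ nm; vlra BL.
exists f.
  move=> n m; case: (ltngtP n m) => // nm _; first exact: disj.
  by rewrite (meetC BL); exact: disj.
move=> n; have [a0 a1] := sub_posp_sub (posp_ge0 BL (w n)) (v0 n).
have [b0 b1] := sub_posp_sub (posp_ge0 BL (- w n)) (v0 n).
have -> : w n - f n = (posp (w n) - posp (posp (w n) - v n))
    - (posp (- w n) - posp (posp (- w n) - v n)).
  have e : w n = posp (w n) - posp (- w n) by rewrite (pospN BL (w n)) addrK.
  by rewrite {1}e /f; apply: (bl_antisym BL); vlra BL.
(* The summand 1 comes from the hypothesis on [S n], the summand C from the norm of the tail
   [r n]. *)
have mv : `|meet (v n) (abs (w n))| <= (1 + C) * 2^-1 ^+ n.
  have h : meet (v n) (abs (w n)) <=v meet (S n) (abs (w n)) + r n.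
    rewrite (meetC BL) (meetC BL (S n)).
    have h1 := meetD_le BL (S0 n) (r0 n) (aw0 n); have h2 := meetr BL (abs (w n)) (r n).
    rewrite -/(v n) in h1; vlra BL.
  apply: le_trans (norm_mono BL (meet_ge0 BL (v0 n) (aw0 n)) h) _.
  by apply: le_trans (ler_normD _ _) _; have := hw n; have := rn n; rewrite -/(S n); lra.
have bnd x p : 0 <=v x -> x <=v meet (v n) p -> p <=v abs (w n) ->
    `|x| <= (1 + C) * 2^-1 ^+ n.
  move=> x0 xp pw; apply: le_trans mv; apply: (norm_mono BL) => //.
  by apply: letr xp _; apply: (meetS BL).
apply: le_trans (ler_normB _ _) _.
have := bnd _ _ a0 a1 (posp_le_labs BL _).
have := bnd _ _ b0 b1; rewrite -(labsN BL) => /(_ (posp_le_labs BL _)); lra.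
Qed.

Hypothesis OC : order_continuous le.

(** At stage n, u is 2^n times the sum of the earlier |w_i|, as [disjoint_approximation] requires.
    The sets [A n] are free, which leaves room to impose stage-dependent conditions on x_n and
    y_n. *)
Lemma almost_disjoint_differences (AA : set (set V)) (C theta : R) :
  (forall A x, AA A -> A x -> `|x| <= C) ->
  (forall A, AA A -> A !=set0) ->
  (forall A x y, AA A -> A x -> A y -> A ((1 / 2) *: (x + y))) ->
  (forall A x, AA A -> A x -> exists A', [/\ AA A', A' `<=` A &
     forall y, A' y -> theta <= `|x - y|]) ->
  forall A : nat -> set V, (forall n, AA (A n)) ->
  exists w f : nat -> V, exists D : R, [/\
    forall n, exists x y, [/\ A n x, A n y & w n = x - y],
    forall n, theta <= `|w n|, disjoint_seq join f &
    forall n, `|w n - f n| <= D * 2^-1 ^+ n].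
Proof.
move=> AC A0 Amid Asep A hA.
have hZ0 (p : nat * V) : exists q : V * V, 0 <=v p.2 ->
    [/\ A p.1 q.1, A p.1 q.2, theta <= `|q.1 - q.2| &
      `|meet (2 ^+ p.1 *: p.2) (abs (q.1 - q.2))| <= 2^-1 ^+ p.1].
  have [p0|p0] := pselect (0 <=v p.2); last by exists (0, 0).
  have u0 : 0 <=v (2 : R) ^+ p.1 *: p.2.
    by rewrite -(scaler0 _ (2 ^+ p.1 : R)); apply: (bl_scale BL) => //; exact: exprn_ge0.
  have e0 : 0 < 2^-1 ^+ p.1 :> R by rewrite exprn_gt0// invr_gt0.
  have [x [y [h1 h2 h3 h4]]] := small_meet_difference BL OC AC A0 Amid Asep (hA p.1) u0 e0.
  by exists (x, y).
have [Z hZ] := choice hZ0.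
pose st n := iter n (fun p : nat * V => (p.1.+1, p.2 + abs ((Z p).1 - (Z p).2))) (0%N, 0).
have st1 n : (st n).1 = n by elim: n => //= n ->.
pose w n := (Z (st n)).1 - (Z (st n)).2.
have st2 n : (st n).2 = \sum_(i < n) abs (w i).
  by elim: n => [|n IH]; [rewrite big_ord0|rewrite big_ord_recr/= -IH].
have stp n : 0 <=v (st n).2.
  elim: n => [|n IH]; first exact: lexv.
  by rewrite /= -(addr0 0); apply: (lev_addv BL) => //; exact: (labs_ge0 BL).
have wP n := hZ (st n) (stp n).
have [||f fd wf] := @disjoint_approximation w (2 * C).
- move=> n; have [h1 h2 _ _] := wP n; apply: le_trans (ler_normB _ _) _.
  by have := AC _ _ (hA _) h1; have := AC _ _ (hA _) h2; lra.
- by move=> n; have [_ _ _] := wP n; rewrite st2 st1.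
exists w, f, (2 * (1 + 2 * C)); split=> //.
- move=> n; exists (Z (st n)).1, (Z (st n)).2.
  by have [h1 h2 _ _] := wP n; rewrite st1 in h1 h2.
- by move=> n; have [] := wP n.
Qed.
End Disjointification.

(** * Functionals on the bidual *)

Lemma closed_seq_limit (R : realType) (V : normedModType R) (E : set V) (x : nat -> V) l :
  closed E -> (forall n, E (x n)) ->
  (forall e : R, 0 < e -> exists N, forall n, (N <= n)%N -> `|x n - l| < e) -> E l.
Proof.
move=> cE Ex xl; apply: cE => B /nbhs_ballP[e /= e0 eB].
have [N /(_ N (leqnn N)) hN] := xl e e0; exists (x N); split=> //.
by apply: eB; rewrite -ball_normE/= distrC.
Qed.

Section Bidual.
Variables (R : realType) (V : completeNormedModType R) (H : normedModType R).
Variables (E : set V) (T : V -> H) (Phi : (V -> R) -> R) (h : H).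
Hypotheses (cE : closed_subspace E) (bT : bounded_linear T) (bPhi : is_bidual E Phi).
Hypothesis PhiT : forall psi, is_dual setT psi -> Phi (psi \o T) = psi h.

Let E0 : E 0. Proof. by case: cE => _ []. Qed.
Let EL (a : R) x y : E x -> E y -> E (a *: x + y).
Proof. by case: cE => _ [_]; apply. Qed.
Let ED x y : E x -> E y -> E (x + y).
Proof. by move=> ? ?; rewrite -[x]scale1r; exact: EL. Qed.
Let EZ (a : R) x : E x -> E (a *: x).
Proof. by move=> ?; rewrite -[_ *: _]addr0; exact: EL. Qed.
Let EB x y : E x -> E y -> E (x - y).
Proof. by move=> ? ?; rewrite addrC -scaleN1r; exact: EL. Qed.

Section IsDual.
Variable phi : V -> R.
Hypothesis hphi : is_dual E phi.

Lemma is_dualD x y : E x -> E y -> phi (x + y) = phi x + phi y.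
Proof. by move=> Ex Ey; have := hphi.1 1 x y Ex Ey; rewrite scale1r mul1r. Qed.

Lemma is_dual0 : phi 0 = 0.
Proof. by have := is_dualD E0 E0; rewrite addr0; lra. Qed.

Lemma is_dualZ (a : R) x : E x -> phi (a *: x) = a * phi x.
Proof. by move=> Ex; have := hphi.1 a x 0 Ex E0; rewrite is_dual0 !addr0. Qed.

Lemma is_dualB x y : E x -> E y -> phi (x - y) = phi x - phi y.
Proof.
move=> Ex Ey; have := hphi.1 (-1) y x Ey Ex; 
by rewrite scaleN1r mulN1r [- y + x]addrC [- phi y + _]addrC.
Qed.

Lemma is_dual_bound : exists2 C : R, 0 <= C & forall x, E x -> `|phi x| <= C * `|x|.
Proof.
case: hphi => _ [C hC]; exists `|C| => // x Ex; apply: le_trans (hC x Ex) _.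
by apply: ler_wpM2r => //; exact: ler_norm.
Qed.

End IsDual.

Lemma is_dual_lincomb (a : R) phi psi : is_dual E phi -> is_dual E psi ->
  is_dual E (fun x => a * phi x + psi x).
Proof.
move=> h1 h2; have [C C0 hC] := is_dual_bound h1; have [D D0 hD] := is_dual_bound h2.
split; first by move=> b x y Ex Ey; rewrite h1.1// h2.1//; lra.
exists (`|a| * C + D) => x Ex; apply: le_trans (ler_normD _ _) _.
rewrite normrM mulrDl -mulrA; apply: lerD; last exact: hD.
by apply: ler_wpM2l => //; exact: hC.
Qed.

Lemma is_dual_linfun phi (C : R) : linfun_R phi -> (forall x, phi x <= C * `|x|) ->
  is_dual E phi /\ forall x, `|phi x| <= C * `|x|.
Proof.
move=> hl hC; have hC' x : `|phi x| <= C * `|x|.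
  by rewrite ler_norml hC andbT; have := hC (- x); rewrite linRN// normrN; lra.
by split=> //; split; [move=> a x y _ _; exact: hl|exists C].
Qed.

Lemma is_dual_zero : is_dual E (fun=> 0).
Proof.
split; first by move=> a x y _ _; rewrite mulr0 addr0.
by exists 0 => x _; rewrite normr0 mul0r.
Qed.

Lemma bidual0 : Phi (fun=> 0) = 0.
Proof.
have [_ [PL _]] := bPhi; have := PL (-1) _ _ is_dual_zero is_dual_zero.
rewrite (_ : (fun=> _) = (fun=> 0)); first lra.
by apply/funext => y; rewrite mulr0 addr0.
Qed.

Lemma bidual_sum n (b : nat -> R) (psi : nat -> V -> R) chi :
  (forall i, is_dual E (psi i)) -> is_dual E chi ->
  is_dual E (fun x => \sum_(i < n) b i * psi i x + chi x) /\
  Phi (fun x => \sum_(i < n) b i * psi i x + chi x) =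
    \sum_(i < n) b i * Phi (psi i) + Phi chi.
Proof.
move=> hpsi hchi; have [_ [PL _]] := bPhi.
elim: n => [|n [IH1 IH2]].
  have -> : (fun x => \sum_(i < 0) b i * psi i x + chi x) = chi.
    by apply/funext => x; rewrite big_ord0 add0r.
  by rewrite big_ord0 add0r.
have -> : (fun x => \sum_(i < n.+1) b i * psi i x + chi x) =
    (fun x => b n * psi n x + (\sum_(i < n) b i * psi i x + chi x)).
  by apply/funext => x; rewrite big_ord_recr/=; lra.
split; first exact: is_dual_lincomb.
by rewrite PL// IH2 big_ord_recr/=; lra.
Qed.

Lemma bidual_bound : exists2 C : R, 0 <= C & forall phi (M : R), is_dual E phi -> 0 <= M ->
  (forall x, E x -> `|phi x| <= M * `|x|) -> `|Phi phi| <= C * M.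
Proof.
case: bPhi => _ [_ [C hC]]; exists `|C| => // phi M h1 M0 h2.
apply: le_trans (hC phi M h1 M0 h2) _; apply: ler_wpM2r => //; exact: ler_norm.
Qed.

Let TL : forall (a : R) x y, T (a *: x + y) = a *: T x + T y.
Proof. by case: bT. Qed.
Let T0 : T 0 = 0.
Proof. by have := TL (-1) 0 0; rewrite scaler0 addr0 scaleN1r addNr. Qed.
Let TD x y : T (x + y) = T x + T y.
Proof. by have := TL 1 x y; rewrite !scale1r. Qed.
Let TZ (a : R) x : T (a *: x) = a *: T x.
Proof. by have := TL a x 0; rewrite T0 !addr0. Qed.

(* Goldstine's theorem relative to T: Hahn-Banach applied, at the point
   ((Phi (psi i))_i, h), to the seminorm q z = inf_x (|x| + lam |z - L x|) on
   R^n * H, where L x = ((psi i x)_i, T x), produces a functional of norm at most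
   1 in E^* on which Phi takes the value q ((Phi (psi i))_i, h). *)
Lemma goldstine (C : R) n (psi : nat -> V -> R) (lam : R) :
  0 <= C -> (forall phi (M : R), is_dual E phi -> 0 <= M ->
    (forall x, E x -> `|phi x| <= M * `|x|) -> `|Phi phi| <= C * M) ->
  (forall i, is_dual E (psi i)) -> 0 < lam ->
  exists x, [/\ E x, `|x| <= C + 1, `|T x - h| <= (C + 1) / lam &
    forall i, (i < n)%N -> `|psi i x - Phi (psi i)| <= (C + 1) / lam].
Proof.
move=> C0 hC hpsi lam0.
pose Z := ('rV[R]_n * H)%type.
pose N (z : Z) := \sum_(i < n) `|z.1 0 i| + `|z.2|.
have N0 z : 0 <= N z by rewrite /N addr_ge0// sumr_ge0.
have ND z z' : N (z + z') <= N z + N z'.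
  rewrite /N addrACA -big_split/=; apply: lerD; last exact: ler_normD.
  by apply: ler_sum => i _; rewrite mxE; exact: ler_normD.
have NZ (t : R) z : 0 < t -> N (t *: z) = t * N z.
  move=> t0; rewrite /N mulrDr mulr_sumr/= normrZ gtr0_norm//; congr (_ + _).
  by apply: eq_bigr => i _; rewrite mxE normrM gtr0_norm.
have N00 : N 0 = 0.
  by rewrite /N/= normr0 addr0 big1// => i _; rewrite mxE normr0.
pose L x : Z := (\row_(i < n) psi i x, T x).
have L0 : L 0 = 0.
  rewrite /L T0; congr (_, _); apply/rowP => i; rewrite !mxE; exact: is_dual0.
have LD x y : E x -> E y -> L (x + y) = L x + L y.
  move=> Ex Ey; rewrite /L TD; congr (_, _); apply/rowP => i; rewrite !mxE.
  exact: is_dualD.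
have LZ (t : R) x : E x -> L (t *: x) = t *: L x.
  move=> Ex; rewrite /L TZ; congr (_, _); apply/rowP => i; rewrite !mxE.
  exact: is_dualZ.
pose F (z : Z) (x : V) := `|x| + lam * N (z - L x).
have F00 : F 0 0 <= 0 by rewrite /F L0 subrr normr0 N00 mulr0 addr0.
have Fge0 z x : E x -> 0 <= F z x.
  by move=> _; rewrite /F addr_ge0// mulr_ge0// ltW.
have FD z z' x y : E x -> E y -> F (z + z') (x + y) <= F z x + F z' y.
  move=> Ex Ey; rewrite /F LD// opprD addrACA.
  by have := ND (z - L x) (z' - L y); have := ler_normD x y; nra.
have FZ (t : R) z x : 0 < t -> E x -> F (t *: z) (t *: x) <= t * F z x.
  by move=> t0 Ex; rewrite /F LZ// -scalerBr NZ// normrZ gtr0_norm//; lra.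
have EZ' (t : R) x : 0 < t -> E x -> E (t *: x) by move=> _; exact: EZ.
have sq := inf_sublinear E0 ED EZ' F00 (Fge0 0) FD FZ.
have qle := inf_sublinear_le E0 (Fge0 0) FD.
pose z0 : Z := (\row_(i < n) Phi (psi i), h).
have [g [gl gq gz0]] := hahn_banach z0 sq.
(* The coefficients of g along the coordinates, extended by 0 to all of [nat] to fit
   [bidual_sum]. *)
pose b (i : nat) := if insub i is Some j then g (delta_mx 0 (j : 'I_n), 0) else 0.
pose chi y := g (0, y).
have bE (i : 'I_n) : b i = g (delta_mx 0 i, 0) by rewrite /b valK.
have chil : linfun_R chi.
  by move=> a x y; rewrite /chi -gl; congr g; congr (_, _); rewrite /= scaler0 addr0.
have chib y : chi y <= lam * `|y|.
  apply: le_trans (gq _) _; apply: le_trans (qle _ _ E0) _.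
  rewrite /F L0 subr0 normr0 add0r /N/= big1 ?add0r// => i _.
  by rewrite mxE normr0.
have chib2 y : `|chi y| <= lam * `|y|.
  by rewrite ler_norml chib andbT; have := chib (- y); rewrite linRN// normrN; lra.
have gE u y : g (u, y) = \sum_(i < n) b i * u 0 i + chi y.
  have -> : (u, y) = \sum_(i < n) u 0 i *: ((delta_mx 0 i, 0) : Z) + (0, y).
    rewrite -[LHS]addr0; apply/eqP; rewrite -subr_eq0; apply/eqP.
    apply: injective_projections => /=.
      rewrite raddf_sum/= addr0 [X in X + _]row_sum_delta addr0; exact: subrr.
    by rewrite raddf_sum/= big1 ?add0r ?addr0 ?subrr// => i _; rewrite scaler0.
  rewrite linRD// linR_sum//; congr (_ + _); apply: eq_bigr => i _.
  by rewrite linRZ// bE mulrC.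
have chiT : is_dual E (chi \o T).
  case: bT => _ [K hK]; split; first by move=> a x y _ _ /=; rewrite TL chil.
  exists (lam * K) => x _ /=; apply: le_trans (chib2 _) _.
  by rewrite -mulrA; apply: ler_wpM2l; [exact: ltW|exact: hK].
have [Psid PhiPsi] := bidual_sum n b hpsi chiT.
have gL x : g (L x) = \sum_(i < n) b i * psi i x + (chi \o T) x.
  by rewrite gE; congr (_ + _); apply: eq_bigr => i _; rewrite mxE.
have gb x : E x -> g (L x) <= `|x|.
  move=> Ex; apply: le_trans (gq _) _; apply: le_trans (qle _ _ Ex) _.
  by rewrite /F subrr N00 mulr0 addr0.
have Psib x : E x -> `|\sum_(i < n) b i * psi i x + (chi \o T) x| <= 1 * `|x|.
  move=> Ex; rewrite -gL mul1r ler_norml gb// andbT.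
  by have := gb _ (EZ (-1) Ex); rewrite LZ// !scaleN1r linRN// normrN; lra.
(* Phi sends [g \o L] to g z0: linearity handles the coordinates and [PhiT] the component
   [chi \o T]. *)
have := hC _ 1 Psid ler01 Psib; rewrite PhiPsi mulr1 PhiT; last first.
  by split; [move=> a x y _ _; exact: chil|exists lam => y _; exact: chib2].
have -> : \sum_(i < n) b i * Phi (psi i) + chi h = g z0.
  by rewrite gE; congr (_ + _); apply: eq_bigr => i _; rewrite mxE.
(* The infimum at z0 is below C + 1, so some x in E has F z0 x < C + 1; both summands of F being
   nonnegative, each obeys this bound. *)
rewrite gz0 => hq; have hq2 := le_lt_trans (le_trans (ler_norm _) hq) (ltr_pwDr ltr01 (lexx C)).
have [x Ex] := inf_sublinear_lt E0 hq2.
rewrite /F => hx.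
have hN : N (z0 - L x) <= (C + 1) / lam.
  by rewrite ler_pdivlMr// mulrC; have := normr_ge0 x; lra.
have hs : 0 <= \sum_(i < n) `|(z0 - L x).1 0 i| by exact: sumr_ge0.
exists x; split=> //.
- by have := N0 (z0 - L x); nra.
- by apply: le_trans hN; rewrite /N distrC lerDr.
- move=> i ni; apply: le_trans hN; rewrite /N (bigD1 (Ordinal ni))//= -addrA distrC !mxE.
  by rewrite lerDl addr_ge0// sumr_ge0.
Qed.

Hypothesis nPhi : ~ exists x, E x /\ forall phi, is_dual E phi -> Phi phi = phi x.

(** E is complete, so its image in the bidual is norm closed, and points of E approaching Phi would
    converge to one representing it. The factor 2 leaves a margin theta once psi is prescribed up to
    theta. *)
Lemma bidual_distance : exists2 theta : R, 0 < theta & forall x, E x ->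
  exists psi, [/\ is_dual E psi, forall y, E y -> `|psi y| <= `|y| &
    2 * theta <= `|Phi psi - psi x|].
Proof.
apply: contrapT => hN; apply: nPhi.
have hx0 (n : nat) : exists x, E x /\ forall psi, is_dual E psi ->
    (forall y, E y -> `|psi y| <= `|y|) -> `|Phi psi - psi x| < 2^-1 ^+ n.
  apply: contrapT => hn; apply: hN; exists (2^-1 ^+ n.+1).
    by rewrite exprn_gt0// invr_gt0.
  move=> x Ex; apply: contrapT => hx; apply: hn; exists x; split=> // psi h1 h2.
  rewrite ltNge; apply/negP => h3; apply: hx; exists psi; split=> //.
  by rewrite exprS; lra.
have [x hx] := choice hx0; have Ex n := (hx n).1.
(* Tested on a norming functional, consecutive points differ by at most 2^-n + 2^-(n+1), whence the
   constant 2. *)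
have [|l [hl1 hl2]] := @geometric_limit R V x 2.
  move=> n; have sn : sublinear (fun y : V => `|y|).
    split=> [y z|t y t0]; first exact: ler_normD.
    by rewrite normrZ ger0_norm.
  have [phi [pl pq pn]] := hahn_banach (x n.+1 - x n) sn.
  have [|pd pb] := @is_dual_linfun phi 1 pl; first by move=> y; rewrite mul1r.
  have pb' y : E y -> `|phi y| <= `|y| by move=> _; have := pb y; rewrite mul1r.
  have q1 : `|Phi phi - phi (x n)| < 2^-1 ^+ n := (hx n).2 _ pd pb'.
  have q2 : `|Phi phi - phi (x n.+1)| < 2^-1 ^+ n.+1 := (hx n.+1).2 _ pd pb'.
  rewrite -pn linRB//; move: q1 q2; rewrite exprS.
  have p0 : 0 < 2^-1 ^+ n :> R by rewrite exprn_gt0// invr_gt0.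
  by rewrite !ltr_norml => /andP[h1 h2] /andP[h3 h4]; lra.
exists l; split; first exact: closed_seq_limit cE.1 Ex hl2.
have El : E l by exact: closed_seq_limit cE.1 Ex hl2.
move=> phi hphi; have [C C0 hC] := is_dual_bound hphi.
have C1 : 0 < C + 1 by lra.
pose psi y := (C + 1)^-1 * phi y + 0.
have hpsi : is_dual E psi by apply: is_dual_lincomb => //; exact: is_dual_zero.
have psib y : E y -> `|psi y| <= `|y|.
  move=> Ey; rewrite /psi addr0 normrM ger0_norm ?invr_ge0 ?(ltW C1)//.
  by rewrite ler_pdivrMl//; have := hC y Ey; have := normr_ge0 y; nra.
have PhiE : Phi psi = psi l.
  apply/eqP; rewrite -subr_eq0 -normr_eq0 eq_le normr_ge0 andbT.
  (* One fifth is spent on passing from Phi to x_N and four on [hl1], whose constant is 2 * 2. *)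
  apply/ler_addgt0Pr => e e0; have e5 : 0 < e / 5 by rewrite divr_gt0.
  have [N /(_ N (leqnn N)) hN'] := half_expr_lt e5.
  have := (hx N).2 _ hpsi psib; have := psib _ (EB (Ex N) El).
  rewrite is_dualB//; have := ler_distD (psi (x N)) (Phi psi) (psi l).
  by have := hl1 N; lra.
have [_ [PL _]] := bPhi.
move: PhiE; rewrite /psi PL//; last exact: is_dual_zero.
by rewrite bidual0 !addr0 => /mulfI; apply; rewrite invr_eq0 gt_eqF.
Qed.

Variables (le : V -> V -> Prop) (join : V -> V -> V).
Hypotheses (BL : is_banach_lattice le join) (OC : order_continuous le).

Lemma nonrepresented_almost_disjoint :
  exists (theta D : R) (w f : nat -> V), [/\ 0 < theta,
    forall n, E (w n) /\ theta <= `|w n|, disjoint_seq join f,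
    forall n, `|w n - f n| <= D * 2^-1 ^+ n &
    forall n, `|T (w n)| <= 2^-1 ^+ n].
Proof.
have [C C0 hC] := bidual_bound; have [theta th0 hth] := bidual_distance.
(* The triple p holds how many functionals count, the functionals, and one tolerance for them and
   for T x. *)
pose A (p : nat * (nat -> V -> R) * R) := [set x | [/\ E x, `|x| <= C + 1,
  `|T x - h| <= p.2 &
  forall i, (i < p.1.1)%N -> `|p.1.2 i x - Phi (p.1.2 i)| <= p.2]].
pose good (p : nat * (nat -> V -> R) * R) := (forall i, is_dual E (p.1.2 i)) /\ 0 < p.2.
pose AA := [set A p | p in good].
have AC B x : AA B -> B x -> `|x| <= C + 1 by move=> [p _ <-] [].
have A0 B : AA B -> B !=set0.
  move=> [[[n psi] e] [/= h1 e0] <-].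
  (* With lam = (C + 1) / e the tolerance (C + 1) / lam of [goldstine] becomes e. *)
  have C1 : 0 < (C + 1) / e by rewrite divr_gt0//; lra.
  have [x [Ex xC xT xpsi]] := goldstine n C0 hC h1 C1.
  rewrite invf_div mulrC divfK in xT xpsi; last by rewrite gt_eqF//; lra.
  by exists x.
have half2 (u : R) : (1 / 2) * (u + u) = u by lra.
have Amid B x y : AA B -> B x -> B y -> B ((1 / 2) *: (x + y)).
  move=> [[[n psi] e] [/= h1 e0] <-] [Ex xC xT xpsi] [Ey yC yT ypsi].
  have k0 : `|1 / 2| = 1 / 2 :> R by rewrite ger0_norm.
  split=> /=.
  - exact: EZ (ED Ex Ey).
  - by rewrite normrZ k0; have := ler_normD x y; lra.
  - have -> : T ((1 / 2) *: (x + y)) - h = (1 / 2) *: ((T x - h) + (T y - h)).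
      rewrite TZ TD addrACA -opprD scalerBr; congr (_ - _).
      have -> : h + h = (2 : R) *: h by rewrite scaler_nat mulr2n.
      by rewrite scalerA (_ : 1 / 2 * 2 = 1 :> R) ?scale1r//; lra.
    by rewrite normrZ k0; have := ler_normD (T x - h) (T y - h); rewrite /= in xT yT; lra.
  - move=> i ni; rewrite (is_dualZ (h1 i)) ?(is_dualD (h1 i))//; last exact: ED.
    have := xpsi i ni; have := ypsi i ni; rewrite /= !ler_norml.
    by move=> /andP[? ?] /andP[? ?]; apply/andP; split; lra.
have Asep B x : AA B -> B x -> exists B', [/\ AA B', B' `<=` B &
    forall y, B' y -> theta <= `|x - y|].
  move=> [[[n psi] e] [/= h1 e0] <-] [Ex xC xT xpsi].
  have [psi' [hd hb ht]] := hth x Ex.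
  pose psi2 i := if i == n then psi' else psi i.
  (* [psi2] puts psi' into slot n, which was not yet constrained. Tolerance theta against the gap 2
     theta leaves |psi' (x - y)| >= theta. *)
  exists (A (n.+1, psi2, Num.min e theta)); split.
  - exists (n.+1, psi2, Num.min e theta) => //; split=> /=; last by rewrite lt_min e0.
    by move=> i; rewrite /psi2; case: eqP.
  - move=> y [Ey yC]; rewrite /= le_min => /andP[yT _] ypsi; split=> // i ni /=.
    have := ypsi i (ltnW ni); rewrite /psi2 ltn_eqF// le_min => /andP[].
    by [].
  - move=> y [Ey yC /= yT ypsi]; have := ypsi n (leqnn _).
    rewrite /psi2 eqxx le_min => /andP[_ hy].
    apply: le_trans (hb _ (EB Ex Ey)); rewrite is_dualB//.
    have := ler_distD (psi' y) (Phi psi') (psi' x).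
    by rewrite (distrC (Phi psi') (psi' y)) (distrC (psi' y) (psi' x)); lra.
(* No functional is prescribed: what matters is that T x and T y stay within 2^-(n+1) of h, so that
   T (x - y) has norm at most 2^-n. *)
have hA n : AA (A (0%N, fun _ _ => 0, 2^-1 ^+ n.+1)).
  exists (0%N, fun _ _ => 0, 2^-1 ^+ n.+1) => //; split=> /=.
    by move=> _; exact: is_dual_zero.
  by rewrite exprn_gt0// invr_gt0.
have [w [f [D [h1 h2 h3 h4]]]] := almost_disjoint_differences BL OC AC A0 Amid Asep hA.
exists theta, D, w, f; split=> // n; have [x [y [[Ex _ xT _] [Ey _ yT _] e]]] := h1 n.
  by split=> //; rewrite e; exact: EB.
rewrite e.
have -> : T (x - y) = (T x - h) - (T y - h).
  by rewrite -scaleN1r TD TZ scaleN1r opprB addrA subrK.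
apply: le_trans (ler_normB _ _) _; rewrite /= in xT yT.
by apply: le_trans (lerD xT yT) _; rewrite exprS; lra.
Qed.
End Bidual.

(** * Operators on the span of a disjoint sequence *)

Section DisjointCoordinates.
Variables (R : realType) (V : completeNormedModType R).
Variables (le : V -> V -> Prop) (join : V -> V -> V).
Hypothesis BL : is_banach_lattice le join.

Local Notation "x '<=v' y" := (le x y) (at level 70).
Local Notation meet := (lmeet join).
Local Notation abs := (labs join).

Let lexv := bl_refl BL.
Let letr := bl_trans BL.

Definition disjoint_compl (g : V) : set V := [set y | meet (abs g) (abs y) = 0].

Lemma labsZ_norm (a : R) x : abs (a *: x) = `|a| *: abs x.
Proof.
have [a0|a0] := leP 0 a; first by rewrite (labsZ BL)// ger0_norm.
by rewrite -(labsN BL) -scaleNr (labsZ BL) ?oppr_ge0 ?ltW// ltr0_norm.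
Qed.

Lemma disjoint_compl0 g : disjoint_compl g 0.
Proof.
have g0 := labs_ge0 BL g; rewrite /disjoint_compl/= (labs_pos BL (lexv 0)).
by apply: (bl_antisym BL); [exact: (meetr BL)|exact: (meet_ge0 BL)].
Qed.

Lemma disjoint_complD g x y : disjoint_compl g x -> disjoint_compl g y ->
  disjoint_compl g (x + y).
Proof.
have a0 z := labs_ge0 BL z.
move=> hx hy; apply: (bl_antisym BL); last exact: (meet_ge0 BL).
have h1 := meetS BL (lexv (abs g)) (labs_triangle BL x y).
have h2 := meetD_le BL (a0 x) (a0 y) (a0 g).
by have := letr h1 h2; rewrite hx hy addr0.
Qed.

Lemma disjoint_complZ g (a : R) x : disjoint_compl g x -> disjoint_compl g (a *: x).
Proof.
move=> hx; rewrite /disjoint_compl/= labsZ_norm -[abs g]scale1r.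
by apply: (meet_scale0 BL) => //; exact: (labs_ge0 BL).
Qed.

(** Meeting |g| <= |g - y| + |y| with |g| removes |y|, so |g| <= |g - y| holds already in the
    lattice. *)
Lemma disjoint_compl_norm g y : disjoint_compl g y -> `|g| <= `|g - y|.
Proof.
move=> hy; rewrite -(norm_labs BL g) -(norm_labs BL (g - y)).
have a0 z := labs_ge0 BL z; apply: (norm_mono BL) => //.
have h1 : abs g <=v abs (g - y) + abs y.
  by have := labs_triangle BL (g - y) y; rewrite subrK.
have h2 := meetP BL (lexv (abs g)) h1.
have h3 := meetD_le BL (a0 (g - y)) (a0 y) (a0 g); rewrite hy addr0 in h3.
by apply: letr (letr h2 h3) _; exact: (meetr BL).
Qed.

(* The distance to the disjoint complement of g is the seminorm dominating the
   coordinate functional. *)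
Lemma disjoint_coordinate g : exists phi, [/\ linfun_R phi,
  forall x, `|phi x| <= `|x|, `|g| <= phi g &
  forall y, disjoint_compl g y -> phi y = 0].
Proof.
pose F (x y : V) := `|x - y|.
have E0 := disjoint_compl0 g.
have EZ (t : R) x : 0 < t -> disjoint_compl g x -> disjoint_compl g (t *: x).
  by move=> _; exact: disjoint_complZ.
have F00 : F 0 0 <= 0 by rewrite /F subrr normr0.
have Fge0 x y : disjoint_compl g y -> 0 <= F x y by move=> _; exact: normr_ge0.
have FD x y i j : disjoint_compl g i -> disjoint_compl g j -> F (x + y) (i + j) <= F x i + F y j.
  by move=> _ _; rewrite /F opprD addrACA; exact: ler_normD.
have FZ (t : R) x i : 0 < t -> disjoint_compl g i -> F (t *: x) (t *: i) <= t * F x i.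
  by move=> t0 _; rewrite /F -scalerBr normrZ gtr0_norm.
have sq := inf_sublinear E0 (@disjoint_complD g) EZ F00 (Fge0 0) FD FZ.
have qle := inf_sublinear_le E0 (Fge0 0) FD.
have [phi [pl pq pg]] := hahn_banach g sq.
have pb x : phi x <= `|x|.
  by apply: le_trans (pq _) _; apply: le_trans (qle _ _ E0) _; rewrite /F subr0.
have py y : disjoint_compl g y -> phi y <= 0.
  by move=> hy; apply: le_trans (pq _) _; apply: le_trans (qle _ _ hy) _; rewrite /F subrr normr0.
exists phi; split=> //.
- by move=> x; rewrite ler_norml pb andbT; have := pb (- x); rewrite linRN// normrN; lra.
- rewrite pg; apply: lb_le_inf; first by exists (F g 0); exists 0.
  by move=> _ [y hy <-]; exact: disjoint_compl_norm.
- move=> y hy; apply/eqP; rewrite eq_le py//=.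
  by have := py _ (disjoint_complZ (-1) hy); rewrite scaleN1r linRN//; lra.
Qed.

End DisjointCoordinates.

Lemma sum_half_expr (R : realType) N n :
  \sum_(N <= i < n) (2^-1 ^+ i : R) <= 2 * 2^-1 ^+ N.
Proof.
have p0 i : 0 < 2^-1 ^+ i :> R by rewrite exprn_gt0// invr_gt0.
have [Nn|nN] := leqP N n; last by rewrite big_geq ?(ltnW nN)// mulr_ge0// ltW.
suff : \sum_(N <= i < n) (2^-1 ^+ i : R) <= 2 * 2^-1 ^+ N - 2 * 2^-1 ^+ n.
  by have := p0 n; lra.
rewrite -(subnKC Nn); elim: (n - N)%N => [|k IH].
  by rewrite addn0 big_geq// subrr.
by rewrite addnS big_nat_recr ?leq_addr//= exprS; lra.
Qed.

Lemma sum_split_le (R : realType) (c : nat -> R) N n : (forall i, 0 <= c i) ->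
  \sum_(0 <= i < n) c i <= \sum_(0 <= i < N) c i + \sum_(N <= i < n) c i.
Proof.
move=> c0; have [Nn|nN] := leqP N n; first by rewrite -big_cat_nat.
rewrite [X in _ <= _ + X]big_geq ?(ltnW nN)// addr0 (@big_cat_nat _ _ _ n 0 N)//= ?(ltnW nN)//.
by rewrite lerDl sumr_ge0.
Qed.

Lemma common_kernel_vector (R : fieldType) n (A : 'I_n.+1 -> 'I_n -> R) :
  exists b : 'I_n.+1 -> R, (exists i, b i != 0) /\
    forall k, \sum_i b i * A i k = 0.
Proof.
pose M := \matrix_(i, k) A i k.
have : kermx M != 0.
  rewrite kermx_eq0 /row_free neq_ltn.
  by rewrite (leq_ltn_trans (rank_leq_col M)).
move=> /rowV0Pn[v /sub_kermxP vM v0].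
exists (fun i => v 0 i); split.
  apply: contrapT => h; case/eqP: v0; apply/rowP => i; rewrite mxE.
  by apply/eqP; apply: contrapT => /negP hi; apply: h; exists i.
move=> k; have /rowP/(_ k) := vM; rewrite !mxE => {2}<-.
by apply: eq_bigr => i _; rewrite mxE.
Qed.

(** * Strict singularity along a disjoint sequence with geometrically small images *)

Section NuclearRestriction.
Variables (R : realType) (V : completeNormedModType R) (H : normedModType R).
Variables (le : V -> V -> Prop) (join : V -> V -> V).
Hypothesis BL : is_banach_lattice le join.

(** On the span the k-th coefficient is at most |phi_k x| / c0, so |T x| is bounded by the first N
    coordinates plus a geometrically small multiple of |x|. An infinite-dimensional M contains a
    nonzero vector killed by the first N functionals, and there T is too small to be bounded
    below. *)
Lemma strictly_singular_on_disjoint_span (T : V -> H) (g : nat -> V) (c0 D : R) :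
  bounded_linear T -> disjoint_seq join g -> 0 < c0 ->
  (forall n, c0 <= `|g n|) -> (forall n, `|T (g n)| <= D * 2^-1 ^+ n) ->
  strictly_singular_on T (span_closure g).
Proof.
move=> [TL [CT0 hCT0]] gd c0p gc gT M MS [M0 [ML Mdim]] [c [cp hc]].
have TD x y : T (x + y) = T x + T y by have := TL 1 x y; rewrite !scale1r.
have T0 : T 0 = 0 by have := TL (-1) 0 0; rewrite scaler0 addr0 scaleN1r addNr.
have TZ (a : R) x : T (a *: x) = a *: T x by have := TL a x 0; rewrite T0 !addr0.
have Tsum n (f : 'I_n -> V) : T (\sum_i f i) = \sum_i T (f i).
  by elim/big_ind2 : _ => // x1 x2 y1 y2 <- <-; rewrite TD.
pose CT := `|CT0|; have hCT x : `|T x| <= CT * `|x|.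
  by apply: le_trans (hCT0 x) _; apply: ler_wpM2r => //; exact: ler_norm.
have p0 i : 0 < 2^-1 ^+ i :> R by rewrite exprn_gt0// invr_gt0.
have D0 : 0 <= D.
  by have := gT 0%N; rewrite expr0 mulr1; apply: le_trans; exact: normr_ge0.
pose K := D / c0; have K0 : 0 <= K by rewrite divr_ge0// ltW.
have [phi hphi] := choice (fun k => disjoint_coordinate BL (g k)).
have phi_g k j : k <> j -> phi k (g j) = 0.
  by move=> kj; have [_ _ _] := hphi k; apply; exact: gd.
have coord n (a : nat -> R) (k : 'I_n) :
    c0 * `|a k| <= `|phi k (\sum_(i < n) a i *: g i)|.
  have [pl _ pg _] := hphi k; rewrite linR_sum// (bigD1 k)//= big1 ?addr0.
    rewrite linRZ// normrM mulrC; apply: ler_wpM2l => //.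
    by apply: le_trans (gc k) _; apply: le_trans pg (ler_norm _).
  move=> i /eqP ik; rewrite linRZ// phi_g ?mulr0// => /esym e.
  by apply: ik; exact: val_inj.
have tail N n (a : nat -> R) (x := \sum_(i < n) a i *: g i) :
    `|T x| <= K * (\sum_(i < N) `|phi i x| + 2 * 2^-1 ^+ N * `|x|).
  (* The first N coordinates are kept; for later ones |phi_i x| <= |x| is combined with the decay of
     T (g i). *)
  pose s i := if (i < N)%N then `|phi i x| else `|x| * 2^-1 ^+ i.
  have s0 i : 0 <= s i by rewrite /s; case: ifP => // _; rewrite mulr_ge0// ltW.
  have h1 : `|T x| <= K * \sum_(0 <= i < n) s i.
    rewrite /x Tsum big_mkord mulr_sumr; apply: le_trans (ler_norm_sum _ _ _) _.
    apply: ler_sum => i _; rewrite TZ normrZ.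
    have ha : `|a i| <= `|phi i x| / c0.
      by rewrite ler_pdivlMr// mulrC; exact: coord.
    have [pl pb _ _] := hphi i.
    rewrite /K mulrAC ler_pdivlMr//.
    have {}ha : `|a i| * c0 <= `|phi i x| by rewrite -ler_pdivlMr.
    have hT := gT i; rewrite /s; case: ifP => _.
      have hT1 : `|T (g i)| <= D.
        have : 2^-1 ^+ i <= 1 :> R by rewrite exprn_ile1 ?invr_ge0// invf_le1// ler1n.
        by move: hT; nra.
      have := normr_ge0 (a i); have := normr_ge0 (T (g i)).
      have : `|T (g i)| * (`|a i| * c0) <= D * `|phi i x|.
        by apply: ler_pM => //; rewrite mulr_ge0// ltW.
      by lra.
    have : `|T (g i)| * (`|a i| * c0) <= (D * 2^-1 ^+ i) * `|x|.
      by apply: ler_pM => //; [rewrite mulr_ge0// ltW|apply: le_trans ha _; exact: pb].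
    by lra.
  apply: le_trans h1 _; apply: ler_wpM2l => //.
  apply: le_trans (sum_split_le N n s0) _; apply: lerD.
    rewrite big_mkord; apply: ler_sum => i _; rewrite /s ltn_ord; exact: lexx.
  rewrite (_ : \sum_(N <= i < n) s i = `|x| * \sum_(N <= i < n) 2^-1 ^+ i).
    by rewrite mulrC; apply: ler_wpM2r => //; exact: sum_half_expr.
  rewrite mulr_sumr; apply: eq_big_nat => i /andP[Ni _].
  by rewrite /s ltnNge Ni.
(* The tail may absorb half of the lower bound c. *)
have [N hN] : exists N, K * (2 * 2^-1 ^+ N) <= c / 2.
  have c4 : 0 < c / (4 * (K + 1)) by rewrite divr_gt0// mulr_gt0//; lra.
  have [N /(_ N (leqnn N)) h] := half_expr_lt c4.
  exists N; move: h; rewrite ltr_pdivlMr; last by rewrite mulr_gt0//; lra.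
  by have := p0 N; nra.
have [v [vM vfree]] := Mdim N.+1.
have [b [[i0 bi0] hb]] := common_kernel_vector (fun (i : 'I_N.+1) (k : 'I_N) => phi k (v i)).
pose x := \sum_(i < N.+1) b i *: v i.
have Mx : M x.
  rewrite /x; elim/big_ind : _ => // [y z My Mz|i _].
    by rewrite -[y]scale1r; exact: ML.
  by rewrite -[_ *: _]addr0; exact: ML.
have phix (k : 'I_N) : phi k x = 0.
  have [pl _ _ _] := hphi k; rewrite -(hb k) /x linR_sum//.
  by apply: eq_bigr => i _; rewrite linRZ.
have x0 : x = 0.
  apply/eqP; rewrite -normr_eq0 eq_le normr_ge0 andbT.
  (* x lies only in the closure of the span. B collects the cost of an approximation x' within e: in
     T, in the N coordinates, and in the norm of x'. *)
  pose B := CT + K * N%:R + K * (2 * 2^-1 ^+ N).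
  have B0 : 0 <= B.
    apply: addr_ge0; [by apply: addr_ge0; [exact: normr_ge0|exact: mulr_ge0]|].
    by apply: mulr_ge0 => //; apply: mulr_ge0 => //; exact: ltW.
  have hx : forall e : R, 0 < e -> c * `|x| <= c / 2 * `|x| + B * e.
    move=> e e0; have [_ [[n [a ->]]]] := MS x Mx _ (nbhsx_ballx x e e0).
    set x' := \sum_(i < n) _; rewrite -ball_normE/= => hxx.
    have h1 : `|T x| <= CT * e + `|T x'|.
      have -> : T x = T (x - x') + T x' by rewrite -TD subrK.
      apply: le_trans (ler_normD _ _) _; rewrite lerD2r.
      apply: le_trans (hCT _) _; apply: ler_wpM2l; [exact: normr_ge0|exact: ltW].
    have h2 := tail N n a; rewrite /= -/x' in h2.
    have h3 : \sum_(i < N) `|phi i x'| <= N%:R * e.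
      have -> : N%:R * e = \sum_(i < N) e by rewrite sumr_const card_ord mulr_natl.
      apply: ler_sum => i _; have [pl pb _ _] := hphi i.
      have -> : phi i x' = - phi i (x - x') by rewrite linRB// phix; lra.
      by rewrite normrN; apply: le_trans (pb _) _; exact: ltW.
    have h4 : `|x'| <= `|x| + e.
      have := ler_normB x (x - x'); rewrite opprB addrC subrK; lra.
    have h5 := hc x Mx.
    have h6 : K * (\sum_(i < N) `|phi i x'|) <= K * (N%:R * e) by apply: ler_wpM2l.
    have h7 : K * (2 * 2^-1 ^+ N) * `|x'| <= K * (2 * 2^-1 ^+ N) * (`|x| + e).
      by apply: ler_wpM2l => //; apply: mulr_ge0 => //; apply: mulr_ge0 => //; exact: ltW.
    have h8 : K * (2 * 2^-1 ^+ N) * `|x| <= c / 2 * `|x| by apply: ler_wpM2r.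
    by rewrite /B; lra.
  have : c / 2 * `|x| <= 0.
    apply/ler_addgt0Pr => e e0; rewrite add0r.
    have B1 : 0 < B + 1 by lra.
    have h := hx (e / (B + 1)) (divr_gt0 e0 B1).
    have : B * (e / (B + 1)) <= e.
      by rewrite mulrA ler_pdivrMr//; nra.
    by lra.
  by rewrite pmulr_rle0// divr_gt0.
pose a (i : nat) := if insub i is Some j then b (j : 'I_N.+1) else 0.
have aE (i : 'I_N.+1) : a i = b i by rewrite /a valK.
have /(vfree a)/(_ i0 (ltn_ord i0)) : \sum_(i < N.+1) a i *: v i = 0.
  by rewrite -[RHS]x0; apply: eq_bigr => i _; rewrite aE.
by rewrite aE => /eqP; rewrite (negbTE bi0).
Qed.
End NuclearRestriction.

Theorem mainTheorem3 (R : realType) (V : completeNormedModType R)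
  (le : V -> V -> Prop) (join : V -> V -> V) :
  is_banach_lattice le join -> order_continuous le ->
  (forall E : set V, closed_subspace E -> dispersed join E -> reflexive_subspace E) /\
  (forall (H : completeNormedModType R) (T : V -> H),
     bounded_linear T -> DNS le join T -> tauberian T).
Proof.
move=> BL OC; split.
  move=> E cE disp Phi bPhi; apply: contrapT => nPhi; apply: disp.
  (* With T = 0 and h = 0 the condition on T in the construction becomes void. *)
  have bT : bounded_linear (fun _ : V => 0 : V).
    split; first by move=> a x y; rewrite scaler0 addr0.
    by exists 0 => x; rewrite normr0 mul0r.
  have PhiT psi : is_dual setT psi -> Phi (psi \o (fun _ : V => 0 : V)) = psi 0.
    case=> hl _; have p0 : psi 0 = 0.
      by have := hl (-1) 0 0 I I; rewrite scaler0 addr0; lra.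
    rewrite (_ : psi \o _ = fun=> 0); last by apply/funext => x /=.
    by rewrite p0; exact: (bidual0 bPhi).
  have [theta [D [w [f [th0 Ew fd wf _]]]]] :=
    nonrepresented_almost_disjoint cE bT bPhi PhiT nPhi BL OC.
  have w0 n : 0 < `|w n| by apply: lt_le_trans th0 (Ew n).2.
  exists (fun n => `|w n|^-1 *: w n); split.
    move=> n; split; last by rewrite normrZ normfV normr_id mulVf// gt_eqF.
    case: cE => _ [E0 EL].
    by have := EL `|w n|^-1 _ _ (Ew n).1 E0; rewrite addr0.
  exists (fun n => `|w n|^-1 *: f n); split.
    move=> n m nm; rewrite !(labsZ_norm BL).
    by apply: (meet_scale0 BL); rewrite ?normr_ge0//; [exact: (labs_ge0 BL)..|exact: fd].
  move=> e e0; have D0 : 0 <= D.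
    by have := wf 0%N; rewrite expr0 mulr1; apply: le_trans; exact: normr_ge0.
  (* Normalizing divides the error by |w_n| >= theta, hence the factor theta; D + 1 covers D = 0. *)
  have c0 : 0 < theta * e / (D + 1) by rewrite divr_gt0 ?mulr_gt0//; lra.
  have [N hN] := half_expr_lt c0; exists N => n Nn.
  rewrite -scalerBr normrZ normfV normr_id ltr_pdivrMl//.
  apply: le_lt_trans (wf n) _; apply: lt_le_trans (_ : theta * e <= _); last first.
    by rewrite ler_pM2r//; exact: (Ew n).2.
  have := hN n Nn; rewrite ltr_pdivlMr; last by lra.
  have : 0 < 2^-1 ^+ n :> R by rewrite exprn_gt0// invr_gt0.
  by lra.
move=> H T bT dns Phi bPhi [h hT]; apply: contrapT => nPhi.
have cE : closed_subspace (setT : set V) by split; [exact: closedT|].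
have nPhi' : ~ exists x, setT x /\ forall phi, is_dual setT phi -> Phi phi = phi x.
  by move=> [x [_ hx]]; apply: nPhi; exists x.
have [theta [D [w [f [th0 Ew fd wf Tw]]]]] :=
  nonrepresented_almost_disjoint cE bT bPhi hT nPhi' BL OC.
have p0 i : 0 < 2^-1 ^+ i :> R by rewrite exprn_gt0// invr_gt0.
have D0 : 0 <= D.
  by have := wf 0%N; rewrite expr0 mulr1; apply: le_trans; exact: normr_ge0.
have c0 : 0 < theta / (2 * (D + 1)) by rewrite divr_gt0//; lra.
have [N hN] := half_expr_lt c0.
(* From N on the error is below theta/2, which forces |f_n| >= theta/2; earlier f_n might vanish,
   while [DNS] speaks of nonzero vectors. *)
pose g n := f (n + N)%N.
have half_le n : 2^-1 ^+ (n + N) <= 2^-1 ^+ n :> R.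
  by rewrite exprD ler_piMr ?(ltW (p0 n))// exprn_ile1 ?invr_ge0// invf_le1// ler1n.
have gn n : theta / 2 <= `|g n|.
  have := hN (n + N)%N (leq_addl _ _); rewrite ltr_pdivlMr; last by lra.
  have := wf (n + N)%N; have := (Ew (n + N)%N).2; have := p0 (n + N)%N.
  by have := ler_distD (f (n + N)%N) (w (n + N)%N) 0; rewrite !subr0 /g; lra.
have [TL [C hC]] := bT.
have gT n : `|T (g n)| <= (1 + `|C| * D) * 2^-1 ^+ n.
  apply: le_trans (_ : (1 + `|C| * D) * 2^-1 ^+ (n + N) <= _); last first.
    by apply: ler_wpM2l => //; rewrite addr_ge0// mulr_ge0.
  have -> : T (g n) = - T (w (n + N)%N - g n) + T (w (n + N)%N).
    have := TL (-1) (w (n + N)%N - g n) (w (n + N)%N).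
    by rewrite !scaleN1r opprB subrK.
  apply: le_trans (ler_normD _ _) _; rewrite normrN mulrDl mul1r addrC.
  apply: lerD => //; apply: le_trans (hC _) _.
  apply: le_trans (_ : `|C| * `|w (n + N)%N - g n| <= _).
    by apply: ler_wpM2r => //; exact: ler_norm.
  by rewrite -mulrA; apply: ler_wpM2l => //; exact: wf.
have th2 : 0 < theta / 2 by rewrite divr_gt0.
apply: (dns g).
- by move=> n /eqP; rewrite -normr_eq0 gt_eqF//; exact: lt_le_trans (gn n).
- by move=> n m nm; apply: fd => /addIn.
- apply: (strictly_singular_on_disjoint_span BL bT _ th2 gn gT).
  by move=> n m nm; apply: fd => /addIn.
Qed.
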